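(* Let $P$ and $Q$ be packed strings of lengths $m$ and $n$, respectively, over an alphabet of size $\sigma$. For any parameter $t$ with $2\le t<2^w$, where $w$ is the word length, the packed string matching problem for $P$ and $Q$ can be solved on the word RAM in time $O\left(\frac{n}{\log_\sigma t}+t+m+\mathrm{occ}\right)$ using $O(t+m)$ words of space. Here $\mathrm{occ}$ is the number of occurrences of $P$ in $Q$.
   Context: Model: a unit-cost word RAM with word length $w=\Theta(\log n)$ bits and a standard instruction set: arithmetic operations, bitwise Boolean operations and shifts, each taking constant time. Space is measured as the number of words used by the algorithm, excluding the input, which is read-only. All strings are over an alphabet $\Sigma$ of size $\sigma\ge 2$. The packed representation of a string $A$ stores $\Theta(\log n/\log\sigma)$ characters per word, so $A$ occupies $O(|A|\log\sigma/\log n)$ words. A packed string is a string given in this representation. The packed string matching problem for packed strings $P$ and $Q$ asks to report all positions $k$ such that the substring $Q[k-m+1,k]$ equals $P$. $\mathrm{occ}$ denotes the number of such positions. *)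

(* Defs.v *)
(* Stdlib only: nat, lists and the classical reals. *)
From Stdlib Require Export Arith List Permutation Reals.
Export ListNotations.

Definition logb (b x : R) : R := (ln x / ln b)%R.

(** ** Packed strings *)

(* Strings over the alphabet {0, ..., sigma - 1}. *)
Definition string_over (sigma : nat) (A : list nat) : Prop :=
  Forall (fun a => a < sigma) A.

Definition char_bits (sigma : nat) : nat := Nat.log2_up sigma.

(* The first character is in the least significant [b] bits. *)
Definition pack_word (b : nat) (s : list nat) : nat :=
  fold_right (fun a x => a + 2 ^ b * x) 0 s.

(* [q] characters of [b] bits each per word; the last word may be partial, its
   remaining bits being 0. There are ceil (|A| / q) words. *)
Definition pack (q b : nat) (A : list nat) : list nat :=
  map (fun i => pack_word b (firstn q (skipn (i * q) A)))
      (seq 0 ((length A + (q - 1)) / q)).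

(** ** The packed string matching problem *)

(* The (1-based) end positions k of the occurrences of P in Q, i.e. those k in
   1..|Q| with k >= |P| and Q[k-m+1, k] = P. *)
Definition occurrences (P Q : list nat) : list nat :=
  let m := length P in
  filter (fun k =>
            (m <=? k) &&
            if list_eq_dec Nat.eq_dec (firstn m (skipn (k - m) Q)) P
            then true else false)%bool
         (seq 1 (length Q)).

Definition occ (P Q : list nat) : nat := length (occurrences P Q).

(** ** The word RAM *)

Inductive binop :=
  | Add | Sub | Mul | Div | Mod
  | And | Or | Xor
  | Shl | Shr.

(* Registers and jump targets are natural numbers fixed in the program text. *)
Inductive instr :=
  | Const (rd c : nat)
  | Bin (op : binop) (rd r1 r2 : nat)
  | Not (rd r : nat)
  | ReadM (rd ra : nat)
  | WriteM (ra rs : nat)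
  | ReadP (rd ra : nat)
  | ReadQ (rd ra : nat)
  | Emit (r : nat)
  | Jump (l : nat)
  | JumpLt (r1 r2 l : nat)
  | JumpEq (r1 r2 l : nat)
  | Halt.

Definition program := list instr.

(* [top] is 1 + the largest working-memory address accessed so far. *)
Record config := Config {
  pc : nat;
  reg : nat -> nat;
  mem : nat -> nat;
  top : nat;
  out : list nat
}.

Definition upd (f : nat -> nat) (i x : nat) : nat -> nat :=
  fun j => if j =? i then x else f j.

(* All results are reduced modulo 2^w, so that registers hold w-bit words. *)
Definition eval_binop (w : nat) (op : binop) (x y : nat) : nat :=
  (match op with
   | Add => x + y
   | Sub => x + 2 ^ w - y
   | Mul => x * y
   | Div => x / y
   | Mod => x mod y
   | And => Nat.land x y
   | Or => Nat.lor x y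
   | Xor => Nat.lxor x y
   | Shl => Nat.shiftl x y
   | Shr => Nat.shiftr x y
   end) mod 2 ^ w.

(* [inP] and [inQ] are the read-only input words, reads past the end giving 0;
   [out] is the write-only output. *)
Definition exec (w : nat) (inP inQ : list nat) (i : instr) (s : config) :
    option config :=
  let r := reg s in
  let set rd x := Config (S (pc s)) (upd r rd x) (mem s) (top s) (out s) in
  let goto l := Config l r (mem s) (top s) (out s) in
  match i with
  | Const rd c => Some (set rd (c mod 2 ^ w))
  | Bin op rd r1 r2 => Some (set rd (eval_binop w op (r r1) (r r2)))
  | Not rd r1 => Some (set rd (2 ^ w - 1 - r r1))
  | ReadM rd ra =>
      Some (Config (S (pc s)) (upd r rd (mem s (r ra))) (mem s)
                   (Nat.max (top s) (S (r ra))) (out s))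
  | WriteM ra rs =>
      Some (Config (S (pc s)) r (upd (mem s) (r ra) (r rs))
                   (Nat.max (top s) (S (r ra))) (out s))
  | ReadP rd ra => Some (set rd (nth (r ra) inP 0))
  | ReadQ rd ra => Some (set rd (nth (r ra) inQ 0))
  | Emit r1 => Some (Config (S (pc s)) r (mem s) (top s) (out s ++ [r r1]))
  | Jump l => Some (goto l)
  | JumpLt r1 r2 l => Some (goto (if r r1 <? r r2 then l else S (pc s)))
  | JumpEq r1 r2 l => Some (goto (if r r1 =? r r2 then l else S (pc s)))
  | Halt => None
  end.

(* [None] means that the machine has halted: it is at a [Halt], or the program
   counter is outside the program. *)
Definition step (prog : program) (w : nat) (inP inQ : list nat) (s : config) :
    option config :=
  match nth_error prog (pc s) with
  | Some i => exec w inP inQ i s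
  | None => None
  end.

Fixpoint steps (prog : program) (w : nat) (inP inQ : list nat) (T : nat)
    (s : config) : option config :=
  match T with
  | 0 => Some s
  | S T' =>
      match step prog w inP inQ s with
      | Some s' => steps prog w inP inQ T' s'
      | None => None
      end
  end.

(* Every instruction costs one unit of time. *)
Definition halts_in (prog : program) (w : nat) (inP inQ : list nat)
    (s : config) (T : nat) (s' : config) : Prop :=
  steps prog w inP inQ T s = Some s' /\ step prog w inP inQ s' = None.

(* Registers 0, 1, ... initially hold [args]; everything else is 0. *)
Definition init (args : list nat) : config :=
  Config 0 (fun i => nth i args 0) (fun _ => 0) 0 [].

Definition instr_regs (i : instr) : list nat :=
  match i with
  | Const rd _ => [rd]
  | Bin _ rd r1 r2 => [rd; r1; r2]
  | Not rd r => [rd; r]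
  | ReadM rd ra => [rd; ra]
  | WriteM ra rs => [ra; rs]
  | ReadP rd ra => [rd; ra]
  | ReadQ rd ra => [rd; ra]
  | Emit r => [r]
  | Jump _ => []
  | JumpLt r1 r2 _ => [r1; r2]
  | JumpEq r1 r2 _ => [r1; r2]
  | Halt => []
  end.

Definition num_regs (prog : program) : nat :=
  S (list_max (flat_map instr_regs prog)).

(* The number of words used by a run of [prog] ending in [s]: its registers and
   the accessed initial segment of the working memory. *)
Definition space (prog : program) (s : config) : nat := num_regs prog + top s.

(** ** Size parameters *)

Definition bitlen (n : nat) : nat := S (Nat.log2 n).

(* w = Theta(log n). The constant in the lower bound is 1, so that the text
   length n, and hence every position to be reported, fits in a word. *)
Definition word_length (c n w : nat) : Prop :=
  n < 2 ^ w /\ w <= c * bitlen n.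

(* q = Theta(log n / log sigma) characters of [char_bits sigma] bits fit in a
   word. Together with [word_length c n w] the first condition bounds q from
   above; the second one bounds it from below, and implies 0 < q. *)
Definition chars_per_word (c n sigma w q : nat) : Prop :=
  q * char_bits sigma <= w /\ bitlen n <= c * (q * char_bits sigma).

(* Main.v *)
Require Import Defs.
From Stdlib Require Import Lia Lra.

(** Let [i < m] be such that [P[0,i)] is a suffix of the text [Q[0,j)] read so
    far, all occurrences starting before [j - i] being reported.  The text is
    read in blocks of [r = Theta(log_sigma t)] characters.  The candidates for
    further occurrences that start at most at [j] correspond to the borders
    [i - d] of [P[0,i)]; those with [d <= r] are stored as a bit mask, one word
    for every [i].  Tables indexed by strings of at most [3 r] characters give
    the set of candidates which survive the next block, those which end in it,
    and the longest prefix of [P] that starts inside it.  If some candidate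
    survives, the oldest one yields the next [i] and [j] grows by [r].
    Otherwise all candidates with [d <= r] are dead.  If [i <= r], then none is
    left but those starting inside the block, and [j] grows by [r]; if [i > r],
    then one step of the failure function from the border [i - d] with the
    largest [d <= r] moves the start [j - i] by more than [r].  Hence there are
    [O(n / r)] rounds.  When [n < 4 m] or [t] is too small for a table, and for
    the last incomplete block, the Knuth-Morris-Pratt algorithm is used.

    The program is written in a small structured language and compiled. *)

(** * A structured language for the word RAM *)

(** A candidate at distance [d <= r] compares [P[i-d, i-d+r)] with the next block, so all of them
    need only the window [P[i-r, i+r)]: its [2 r] characters and the block make up the [3 r]. With
    [N = 2^(r b)] the largest table has [N^3] entries of [r + 1 <= N] tests each, so [N^4 = O(t)] is
    what the time bound asks for; [N^8 <= t] leaves room for all the rest. The limit [r <= q / 2]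
    lets the window be read from two packed words.

    Rounds are counted by [2 j - i], which never exceeds [2 n] and grows by at least [r] in each of
    the three cases, also when the failure function is applied and [j] stays. The same block is then
    read again, but nothing is reported twice, since the new start [j - i] lies beyond the starts of
    all occurrences that end in the block.

    The obstacle is the word length: [m], [n] and [t] may all be close to [2^w], yet addresses and
    intermediate results must fit in a word. If [4 m <= n], then [2 m] cells and the tables stay
    below [2^w]; if not, then [O(n)] is [O(m)], and no tables are needed. For the same reason
    several tests are written with shifts or differences instead of products or sums. *)

Inductive expr :=
  | Var (x : nat)
  | Cst (k : nat)
  | Op (o : binop) (e1 e2 : expr)
  | PWord (e : expr)
  | QWord (e : expr)
  | Mem (e : expr).

Inductive cond :=
  | CLt (e1 e2 : expr)
  | CEq (e1 e2 : expr).

Inductive cmd :=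
  | Skip
  | Assign (x : nat) (e : expr)
  | Store (ea ev : expr)
  | Out (e : expr)
  | Seq (c1 c2 : cmd)
  | If (g : cond) (c1 c2 : cmd)
  | While (g : cond) (c : cmd).

Record state := St { env : nat -> nat; smem : nat -> nat; sout : list nat }.

Definition set (x v : nat) (s : state) : state :=
  St (upd (env s) x v) (smem s) (sout s).
Definition store (a v : nat) (s : state) : state :=
  St (env s) (upd (smem s) a v) (sout s).
Definition emit (v : nat) (s : state) : state :=
  St (env s) (smem s) (sout s ++ [v]).

Section Semantics.

Variables (w : nat) (inP inQ : list nat) (A : nat).

(* Only overflow-free evaluations are allowed, left shifts excepted, and only
   the memory cells below [A] may be accessed. *)
Inductive ev (s : state) : expr -> nat -> Prop :=
  | ev_var x v : env s x = v -> ev s (Var x) v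
  | ev_cst k : k < 2 ^ w -> ev s (Cst k) k
  | ev_add e1 e2 x y : ev s e1 x -> ev s e2 y -> x + y < 2 ^ w ->
      ev s (Op Add e1 e2) (x + y)
  | ev_sub e1 e2 x y : ev s e1 x -> ev s e2 y -> y <= x ->
      ev s (Op Sub e1 e2) (x - y)
  | ev_mul e1 e2 x y : ev s e1 x -> ev s e2 y -> x * y < 2 ^ w ->
      ev s (Op Mul e1 e2) (x * y)
  | ev_div e1 e2 x y : ev s e1 x -> ev s e2 y -> ev s (Op Div e1 e2) (x / y)
  | ev_mod e1 e2 x y : ev s e1 x -> ev s e2 y -> ev s (Op Mod e1 e2) (x mod y)
  | ev_and e1 e2 x y : ev s e1 x -> ev s e2 y ->
      ev s (Op And e1 e2) (Nat.land x y)
  | ev_or e1 e2 x y : ev s e1 x -> ev s e2 y ->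
      ev s (Op Or e1 e2) (Nat.lor x y)
  | ev_xor e1 e2 x y : ev s e1 x -> ev s e2 y ->
      ev s (Op Xor e1 e2) (Nat.lxor x y)
  | ev_shl e1 e2 x y : ev s e1 x -> ev s e2 y ->
      ev s (Op Shl e1 e2) (Nat.shiftl x y mod 2 ^ w)
  | ev_shr e1 e2 x y : ev s e1 x -> ev s e2 y ->
      ev s (Op Shr e1 e2) (Nat.shiftr x y)
  | ev_P e x : ev s e x -> ev s (PWord e) (nth x inP 0)
  | ev_Q e x : ev s e x -> ev s (QWord e) (nth x inQ 0)
  | ev_mem e x : ev s e x -> x < A -> ev s (Mem e) (smem s x).

Inductive evc (s : state) : cond -> bool -> Prop :=
  | evc_lt e1 e2 x y : ev s e1 x -> ev s e2 y -> evc s (CLt e1 e2) (x <? y)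
  | evc_eq e1 e2 x y : ev s e1 x -> ev s e2 y -> evc s (CEq e1 e2) (x =? y).

(* The counter is the number of assignments, outputs and tests. *)
Inductive run : cmd -> state -> nat -> state -> Prop :=
  | run_skip s : run Skip s 0 s
  | run_assign s x e v : ev s e v -> run (Assign x e) s 1 (set x v s)
  | run_store s ea e a v : ev s ea a -> ev s e v -> a < A ->
      run (Store ea e) s 1 (store a v s)
  | run_out s e v : ev s e v -> run (Out e) s 1 (emit v s)
  | run_seq c1 c2 s T1 s1 T2 s2 : run c1 s T1 s1 -> run c2 s1 T2 s2 ->
      run (Seq c1 c2) s (T1 + T2) s2
  | run_if g c1 c2 s f T s' : evc s g f -> run (if f then c1 else c2) s T s' ->
      run (If g c1 c2) s (S T) s'
  | run_while_stop g c s : evc s g false -> run (While g c) s 1 s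
  | run_while_step g c s T1 s1 T2 s2 : evc s g true -> run c s T1 s1 ->
      run (While g c) s1 T2 s2 -> run (While g c) s (S (T1 + T2)) s2.

(** * Weakest preconditions with costs *)

Definition wp (c : cmd) (Phi : nat -> state -> Prop) (s : state) : Prop :=
  exists T s', run c s T s' /\ Phi T s'.

Lemma wp_conseq c (Phi Psi : nat -> state -> Prop) s :
  wp c Phi s -> (forall T s', Phi T s' -> Psi T s') -> wp c Psi s.
Proof. intros (T & s' & H & HP) HI; exists T, s'; auto. Qed.

Lemma wp_skip (Phi : nat -> state -> Prop) s : Phi 0 s -> wp Skip Phi s.
Proof. intros H; exists 0, s; split; [constructor | auto]. Qed.

Lemma wp_assign x e v (Phi : nat -> state -> Prop) s :
  ev s e v -> Phi 1 (set x v s) -> wp (Assign x e) Phi s.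
Proof. intros He H; exists 1, (set x v s); split; [constructor|]; auto. Qed.

Lemma wp_store ea e a v (Phi : nat -> state -> Prop) s :
  ev s ea a -> ev s e v -> a < A -> Phi 1 (store a v s) ->
  wp (Store ea e) Phi s.
Proof. intros; exists 1, (store a v s); split; [constructor|]; auto. Qed.

Lemma wp_out e v (Phi : nat -> state -> Prop) s :
  ev s e v -> Phi 1 (emit v s) -> wp (Out e) Phi s.
Proof. intros; exists 1, (emit v s); split; [constructor|]; auto. Qed.

Lemma wp_seq c1 c2 (Phi : nat -> state -> Prop) s :
  wp c1 (fun T1 => wp c2 (fun T2 => Phi (T1 + T2))) s -> wp (Seq c1 c2) Phi s.
Proof.
  intros (T1 & s1 & H1 & T2 & s2 & H2 & HP).
  exists (T1 + T2), s2; split; [econstructor; eauto | auto].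
Qed.

Lemma wp_if g f c1 c2 (Phi : nat -> state -> Prop) s :
  evc s g f -> wp (if f then c1 else c2) (fun T => Phi (S T)) s ->
  wp (If g c1 c2) Phi s.
Proof.
  intros Hg (T & s1 & H & HP).
  exists (S T), s1; split; [econstructor; eauto | auto].
Qed.

Lemma wp_if_lt e1 e2 x y c1 c2 (Phi : nat -> state -> Prop) s :
  ev s e1 x -> ev s e2 y ->
  (x < y -> wp c1 (fun T => Phi (S T)) s) ->
  (y <= x -> wp c2 (fun T => Phi (S T)) s) ->
  wp (If (CLt e1 e2) c1 c2) Phi s.
Proof.
  intros H1 H2 Ht Hf. eapply wp_if; [constructor; eassumption|].
  destruct (Nat.ltb_spec x y); auto.
Qed.

Lemma wp_if_eq e1 e2 x y c1 c2 (Phi : nat -> state -> Prop) s :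
  ev s e1 x -> ev s e2 y ->
  (x = y -> wp c1 (fun T => Phi (S T)) s) ->
  (x <> y -> wp c2 (fun T => Phi (S T)) s) ->
  wp (If (CEq e1 e2) c1 c2) Phi s.
Proof.
  intros H1 H2 Ht Hf. eapply wp_if; [constructor; eassumption|].
  destruct (Nat.eqb_spec x y); auto.
Qed.

(* The potential [phi] pays for the iterations, so it also proves
   termination. *)
Lemma wp_while e1 e2 c (x y phi : state -> nat) (I : state -> Prop) s :
  I s ->
  (forall s, I s -> ev s e1 (x s) /\ ev s e2 (y s)) ->
  (forall s, I s -> x s < y s ->
     wp c (fun T s' => I s' /\ S T + phi s' <= phi s) s) ->
  wp (While (CLt e1 e2) c)
     (fun T s' => I s' /\ y s' <= x s' /\ T + phi s' <= S (phi s)) s.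
Proof.
  intros HI He Hc.
  remember (phi s) as k eqn:Hk. revert s Hk HI.
  induction k as [k IH] using (well_founded_induction lt_wf); intros s Hk HI.
  destruct (He s HI) as [E1 E2].
  assert (E : evc s (CLt e1 e2) (x s <? y s)) by (constructor; auto).
  destruct (Nat.ltb_spec (x s) (y s)) as [Hlt | Hge].
  - destruct (Hc s HI Hlt) as (T1 & s1 & R1 & HI1 & HT1).
    destruct (IH (phi s1) ltac:(lia) s1 eq_refl HI1)
      as (T2 & s2 & R2 & HI2 & Hstop & HT2).
    exists (S (T1 + T2)), s2. split; [eapply run_while_step; eauto|].
    repeat split; auto; lia.
  - exists 1, s. split; [apply run_while_stop; auto|].
    repeat split; auto; lia.
Qed.

(** * Compilation *)

(* Registers below [nv] hold the variables, the others are temporaries. *)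
Definition nv : nat := 32.

(** The temporaries from [nv + k] on serve as an evaluation stack, and the value is left in
    [nv + k]. There is no move instruction; the [Or] of a register with itself copies it. *)
Fixpoint cexp (k : nat) (e : expr) : list instr :=
  match e with
  | Var x => [Bin Or (nv + k) x x]
  | Cst n => [Const (nv + k) n]
  | Op o e1 e2 =>
      cexp k e1 ++ cexp (S k) e2 ++ [Bin o (nv + k) (nv + k) (nv + S k)]
  | PWord e => cexp k e ++ [ReadP (nv + k) (nv + k)]
  | QWord e => cexp k e ++ [ReadQ (nv + k) (nv + k)]
  | Mem e => cexp k e ++ [ReadM (nv + k) (nv + k)]
  end.

Definition ccond (g : cond) (l : nat) : list instr :=
  match g with
  | CLt e1 e2 => cexp 0 e1 ++ cexp 1 e2 ++ [JumpLt (nv + 0) (nv + 1) l]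
  | CEq e1 e2 => cexp 0 e1 ++ cexp 1 e2 ++ [JumpEq (nv + 0) (nv + 1) l]
  end.

Definition gsize (g : cond) : nat := length (ccond g 0).

Fixpoint csize (c : cmd) : nat :=
  match c with
  | Skip => 0
  | Assign _ e => length (cexp 0 e) + 1
  | Store ea e => length (cexp 0 ea) + length (cexp 1 e) + 1
  | Out e => length (cexp 0 e) + 1
  | Seq c1 c2 => csize c1 + csize c2
  | If g c1 c2 => gsize g + csize c2 + 1 + csize c1
  | While g c => gsize g + 1 + csize c + 1
  end.

(** The conditional jump is taken when the test holds, so the other continuation comes first: the
    false branch of [If], the exit of [While]. Code sizes do not depend on labels, which allows
    forward targets to be computed from [csize]. *)
Fixpoint comp (off : nat) (c : cmd) : list instr :=
  match c with
  | Skip => []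
  | Assign x e => cexp 0 e ++ [Bin Or x (nv + 0) (nv + 0)]
  | Store ea e => cexp 0 ea ++ cexp 1 e ++ [WriteM (nv + 0) (nv + 1)]
  | Out e => cexp 0 e ++ [Emit (nv + 0)]
  | Seq c1 c2 => comp off c1 ++ comp (off + csize c1) c2
  | If g c1 c2 =>
      let l := off + gsize g + csize c2 + 1 in
      ccond g l ++ comp (off + gsize g) c2 ++ [Jump (l + csize c1)]
      ++ comp l c1
  | While g c =>
      let l := off + gsize g + 1 in
      ccond g l ++ [Jump (l + csize c + 1)] ++ comp l c ++ [Jump off]
  end.

Lemma gsize_eq g l : length (ccond g l) = gsize g.
Proof. destruct g; unfold gsize; cbn; rewrite !length_app; auto. Qed.

Lemma csize_eq c off : length (comp off c) = csize c.
Proof.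
  revert off; induction c as [| | | |c1 IH1 c2 IH2|g c1 IH1 c2 IH2|g c IH];
    intros off; cbn [comp csize]; rewrite ?length_app, ?gsize_eq;
    cbn [length app]; rewrite ?length_app, ?IH1, ?IH2, ?IH; cbn [length];
    rewrite ?IH1; lia.
Qed.

Fixpoint expr_vars (e : expr) : bool :=
  match e with
  | Var x => x <? nv
  | Cst _ => true
  | Op _ e1 e2 => expr_vars e1 && expr_vars e2
  | PWord e | QWord e | Mem e => expr_vars e
  end.

Definition cond_vars (g : cond) : bool :=
  match g with CLt e1 e2 | CEq e1 e2 => expr_vars e1 && expr_vars e2 end.

Fixpoint cmd_vars (c : cmd) : bool :=
  match c with
  | Skip => true
  | Assign x e => (x <? nv) && expr_vars e
  | Store e1 e2 => expr_vars e1 && expr_vars e2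
  | Out e => expr_vars e
  | Seq c1 c2 => cmd_vars c1 && cmd_vars c2
  | If g c1 c2 => cond_vars g && (cmd_vars c1 && cmd_vars c2)
  | While g c => cond_vars g && cmd_vars c
  end.

Definition code_at (prog : program) (off : nat) (l : list instr) : Prop :=
  exists pre post, prog = pre ++ l ++ post /\ length pre = off.

Lemma code_at_app prog off l1 l2 :
  code_at prog off (l1 ++ l2) ->
  code_at prog off l1 /\ code_at prog (off + length l1) l2.
Proof.
  intros (pre & post & -> & <-); split.
  - exists pre, (l2 ++ post); rewrite <- !app_assoc; auto.
  - exists (pre ++ l1), post; rewrite <- !app_assoc, length_app; auto.
Qed.

Lemma code_at_nth prog off i :
  code_at prog off [i] -> nth_error prog off = Some i.
Proof.
  intros (pre & post & -> & <-).
  rewrite nth_error_app2, Nat.sub_diag by lia; reflexivity.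
Qed.

(** Temporaries are left unrelated. The clause on [top] carries the space bound through the whole
    run. *)
Definition Rel (s : state) (k : config) : Prop :=
  (forall x, x < nv -> reg k x = env s x) /\ mem k = smem s /\
  out k = sout s /\ top k <= A.

Definition wf (s : state) : Prop :=
  (forall x, env s x < 2 ^ w) /\ (forall a, smem s a < 2 ^ w).

Hypothesis inP_lt : forall x, nth x inP 0 < 2 ^ w.
Hypothesis inQ_lt : forall x, nth x inQ 0 < 2 ^ w.

Lemma lt_pow2_testbit x k :
  (forall i, k <= i -> Nat.testbit x i = false) -> x < 2 ^ k.
Proof.
  intros H. destruct (Nat.eq_dec x 0) as [->|Hx].
  - apply Nat.neq_0_lt_0, Nat.pow_nonzero; lia.
  - apply Nat.log2_lt_pow2; [lia|].
    destruct (Nat.lt_ge_cases (Nat.log2 x) k) as [|Hk]; auto.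
    apply H in Hk. rewrite Nat.bit_log2 in Hk; congruence.
Qed.

Lemma testbit_lt_pow2 x k i : x < 2 ^ k -> k <= i -> Nat.testbit x i = false.
Proof.
  intros Hx Hi. destruct (Nat.eq_dec x 0) as [->|H0].
  - apply Nat.bits_0.
  - apply Nat.bits_above_log2.
    apply Nat.log2_lt_pow2 in Hx; lia.
Qed.

Lemma ev_lt s e v : wf s -> ev s e v -> v < 2 ^ w.
Proof.
  intros [W1 W2]; induction 1; auto; subst; auto.
  - lia.
  - destruct y as [|y]; [cbn; lia|].
    eapply Nat.le_lt_trans; [apply Nat.Div0.div_le_upper_bound|exact IHev1].
    apply Nat.le_add_r.
  - eapply Nat.le_lt_trans; [apply Nat.Div0.mod_le|exact IHev1].
  - apply lt_pow2_testbit; intros i Hi.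
    rewrite Nat.land_spec, (testbit_lt_pow2 x w i); auto.
  - apply lt_pow2_testbit; intros i Hi.
    rewrite Nat.lor_spec, (testbit_lt_pow2 x w i), (testbit_lt_pow2 y w i);
      auto.
  - apply lt_pow2_testbit; intros i Hi.
    rewrite Nat.lxor_spec, (testbit_lt_pow2 x w i), (testbit_lt_pow2 y w i);
      auto.
  - apply Nat.mod_upper_bound, Nat.pow_nonzero; lia.
  - apply lt_pow2_testbit; intros i Hi.
    rewrite Nat.shiftr_spec', (testbit_lt_pow2 x w); auto; lia.
Qed.

(** Without overflow the reduction modulo [2^w] is invisible; in a subtraction the summand [2^w] is
    removed by it because [y <= x]. *)
Lemma ev_op_inv s o e1 e2 v :
  wf s -> ev s (Op o e1 e2) v ->
  exists x y, ev s e1 x /\ ev s e2 y /\ eval_binop w o x y = v.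
Proof.
  intros W H. pose proof (ev_lt _ _ _ W H) as Hv.
  inversion H; subst; exists x, y; (split; [assumption|split; [assumption|]]);
    unfold eval_binop; try (apply Nat.mod_small; exact Hv); auto.
  replace (x + 2 ^ w - y) with (x - y + 1 * 2 ^ w) by lia.
  rewrite Nat.Div0.mod_add. apply Nat.mod_small; auto.
Qed.

Lemma steps_app prog T1 T2 k k1 :
  steps prog w inP inQ T1 k = Some k1 ->
  steps prog w inP inQ (T1 + T2) k = steps prog w inP inQ T2 k1.
Proof.
  revert k; induction T1 as [|T1 IH]; intros k H; cbn in *.
  - congruence.
  - destruct (step prog w inP inQ k); [auto|discriminate].
Qed.

Lemma steps_one prog k i k' :
  code_at prog (pc k) [i] -> exec w inP inQ i k = Some k' ->
  steps prog w inP inQ 1 k = Some k'.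
Proof.
  intros H E; cbn. unfold step. rewrite (code_at_nth _ _ _ H), E; auto.
Qed.

(** The last clause keeps the value of a left operand intact while the right one is evaluated one
    register higher. *)
Lemma cexp_correct prog s e : wf s -> forall v k c,
  ev s e v -> expr_vars e = true ->
  code_at prog (pc c) (cexp k e) -> Rel s c ->
  exists c', steps prog w inP inQ (length (cexp k e)) c = Some c' /\
    pc c' = pc c + length (cexp k e) /\ Rel s c' /\ reg c' (nv + k) = v /\
    (forall x, x < nv + k -> reg c' x = reg c x).
Proof.
  intros W. induction e as [x|n|o e1 IH1 e2 IH2|e IH|e IH|e IH];
    intros v k c Hev Hx Hat HR; pose proof (ev_lt _ _ _ W Hev) as Hv;
    cbn [cexp expr_vars] in *.
  - inversion Hev as [? ? E| | | | | | | | | | | | | |]; subst.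
    apply Nat.ltb_lt in Hx. pose proof HR as (R1 & R2 & R3 & R4).
    eexists; split; [eapply steps_one; [eassumption|reflexivity]|].
    cbn [pc length]. unfold eval_binop. rewrite Nat.lor_diag, (R1 x) by auto.
    split; [lia|]. unfold Rel, upd; cbn [reg mem out top].
    repeat split; auto.
    + intros y Hy. destruct (Nat.eqb_spec y (nv + k)); [lia|auto].
    + rewrite Nat.eqb_refl. apply Nat.mod_small; auto.
    + intros y Hy. destruct (Nat.eqb_spec y (nv + k)); [lia|auto].
  - inversion Hev; subst. pose proof HR as (R1 & R2 & R3 & R4).
    eexists; split; [eapply steps_one; [eassumption|reflexivity]|].
    cbn [pc length]. split; [lia|]. unfold Rel, upd; cbn [reg mem out top].
    repeat split; auto.
    + intros y Hy. destruct (Nat.eqb_spec y (nv + k)); [lia|auto].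
    + rewrite Nat.eqb_refl. apply Nat.mod_small; auto.
    + intros y Hy. destruct (Nat.eqb_spec y (nv + k)); [lia|auto].
  - destruct (ev_op_inv _ _ _ _ _ W Hev) as (x & y & E1 & E2 & Eo).
    apply andb_prop in Hx as [Hx1 Hx2].
    apply code_at_app in Hat as [Hat1 Hat].
    apply code_at_app in Hat as [Hat2 Hat3].
    destruct (IH1 _ k c E1 Hx1 Hat1 HR) as (c1 & S1 & P1 & RR1 & V1 & F1).
    rewrite <- P1 in Hat2.
    destruct (IH2 _ (S k) c1 E2 Hx2 Hat2 RR1) as (c2 & S2 & P2 & RR2 & V2 & F2).
    rewrite <- P1, <- P2 in Hat3.
    pose proof RR2 as (R1 & R2 & R3 & R4).
    eexists. rewrite !length_app. split.
    { rewrite (steps_app _ _ _ _ _ S1), (steps_app _ _ _ _ _ S2).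
      eapply steps_one; [eassumption|reflexivity]. }
    cbn [pc length]. split; [lia|]. unfold Rel, upd; cbn [reg mem out top].
    repeat split; auto.
    + intros z Hz. destruct (Nat.eqb_spec z (nv + k)); [lia|auto].
    + rewrite Nat.eqb_refl, V2, F2, V1 by lia. auto.
    + intros z Hz. destruct (Nat.eqb_spec z (nv + k)); [lia|].
      rewrite F2, F1; auto; lia.
  - inversion Hev as [| | | | | | | | | | | |? x E| |]; subst.
    apply code_at_app in Hat as [Hat1 Hat2].
    destruct (IH _ k c E Hx Hat1 HR) as (c1 & S1 & P1 & RR1 & V1 & F1).
    rewrite <- P1 in Hat2. pose proof RR1 as (R1 & R2 & R3 & R4).
    eexists. rewrite !length_app. split.
    { rewrite (steps_app _ _ _ _ _ S1).
      eapply steps_one; [eassumption|reflexivity]. }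
    cbn [pc length]. split; [lia|]. unfold Rel, upd; cbn [reg mem out top].
    repeat split; auto.
    + intros z Hz. destruct (Nat.eqb_spec z (nv + k)); [lia|auto].
    + rewrite Nat.eqb_refl, V1; auto.
    + intros z Hz. destruct (Nat.eqb_spec z (nv + k)); [lia|].
      rewrite F1; auto; lia.
  - inversion Hev as [| | | | | | | | | | | | |? x E|]; subst.
    apply code_at_app in Hat as [Hat1 Hat2].
    destruct (IH _ k c E Hx Hat1 HR) as (c1 & S1 & P1 & RR1 & V1 & F1).
    rewrite <- P1 in Hat2. pose proof RR1 as (R1 & R2 & R3 & R4).
    eexists. rewrite !length_app. split.
    { rewrite (steps_app _ _ _ _ _ S1).
      eapply steps_one; [eassumption|reflexivity]. }
    cbn [pc length]. split; [lia|]. unfold Rel, upd; cbn [reg mem out top].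
    repeat split; auto.
    + intros z Hz. destruct (Nat.eqb_spec z (nv + k)); [lia|auto].
    + rewrite Nat.eqb_refl, V1; auto.
    + intros z Hz. destruct (Nat.eqb_spec z (nv + k)); [lia|].
      rewrite F1; auto; lia.
  - inversion Hev as [| | | | | | | | | | | | | |? x E HA]; subst.
    apply code_at_app in Hat as [Hat1 Hat2].
    destruct (IH _ k c E Hx Hat1 HR) as (c1 & S1 & P1 & RR1 & V1 & F1).
    rewrite <- P1 in Hat2. pose proof RR1 as (R1 & R2 & R3 & R4).
    eexists. rewrite !length_app. split.
    { rewrite (steps_app _ _ _ _ _ S1).
      eapply steps_one; [eassumption|reflexivity]. }
    cbn [pc length]. split; [lia|]. unfold Rel, upd; cbn [reg mem out top].
    repeat split; auto.
    + intros z Hz. destruct (Nat.eqb_spec z (nv + k)); [lia|auto].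
    + rewrite V1; lia.
    + rewrite Nat.eqb_refl, V1, R2; auto.
    + intros z Hz. destruct (Nat.eqb_spec z (nv + k)); [lia|].
      rewrite F1; auto; lia.
Qed.

Lemma two_exps prog s e1 e2 x y c l :
  wf s -> ev s e1 x -> ev s e2 y ->
  (expr_vars e1 && expr_vars e2)%bool = true ->
  code_at prog (pc c) (cexp 0 e1 ++ cexp 1 e2 ++ l) -> Rel s c ->
  exists c', steps prog w inP inQ (length (cexp 0 e1) + length (cexp 1 e2)) c
      = Some c' /\
    pc c' = pc c + length (cexp 0 e1) + length (cexp 1 e2) /\ Rel s c' /\
    reg c' (nv + 0) = x /\ reg c' (nv + 1) = y /\ code_at prog (pc c') l.
Proof.
  intros W E1 E2 Hx Hat HR. apply andb_prop in Hx as [Hx1 Hx2].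
  apply code_at_app in Hat as [Hat1 Hat].
  apply code_at_app in Hat as [Hat2 Hat3].
  destruct (cexp_correct prog s e1 W x 0 c E1 Hx1 Hat1 HR)
    as (c1 & S1 & P1 & R1 & V1 & F1).
  rewrite <- P1 in Hat2, Hat3.
  destruct (cexp_correct prog s e2 W y 1 c1 E2 Hx2 Hat2 R1)
    as (c2 & S2 & P2 & R2 & V2 & F2).
  exists c2. rewrite (steps_app _ _ _ _ _ S1), P2, P1.
  repeat split; try apply R2; auto.
  - rewrite F2; auto; lia.
  - rewrite <- P1; auto.
Qed.

Lemma ccond_correct prog s g f l c :
  wf s -> evc s g f -> cond_vars g = true ->
  code_at prog (pc c) (ccond g l) -> Rel s c ->
  exists c', steps prog w inP inQ (gsize g) c = Some c' /\
    pc c' = (if f then l else pc c + gsize g) /\ Rel s c'.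
Proof.
  intros W E Hx Hat HR.
  destruct E as [e1 e2 x y E1 E2|e1 e2 x y E1 E2]; cbn [cond_vars ccond] in *;
    destruct (two_exps prog s e1 e2 x y c _ W E1 E2 Hx Hat HR)
      as (c1 & S1 & P1 & R1 & V1 & V2 & Hat1);
    (eexists; unfold gsize; cbn [ccond]; rewrite !length_app, Nat.add_assoc;
     split; [rewrite (steps_app _ _ _ _ _ S1); eapply steps_one;
             [eassumption|reflexivity]|]);
    cbn [pc length]; rewrite V1, V2, P1;
    (split; [|exact R1]).
  - destruct (x <? y); lia.
  - destruct (x =? y); lia.
Qed.

Lemma wf_set s x v : wf s -> v < 2 ^ w -> wf (set x v s).
Proof.
  intros [H1 H2] Hv; split; cbn; auto.
  intros y; unfold upd; destruct (y =? x); auto.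
Qed.

Lemma wf_store s a v : wf s -> v < 2 ^ w -> wf (store a v s).
Proof.
  intros [H1 H2] Hv; split; cbn; auto.
  intros y; unfold upd; destruct (y =? a); auto.
Qed.

(** Each counted step of the source executes straight-line code shorter than the whole program, so a
    bound [B] on the code size is a valid cost factor. The induction is on the run, because a loop
    executes its own code again. *)
Lemma comp_correct prog B c s T s' :
  run c s T s' -> forall k,
  code_at prog (pc k) (comp (pc k) c) -> Rel s k -> wf s ->
  cmd_vars c = true -> csize c <= B ->
  exists T' k', steps prog w inP inQ T' k = Some k' /\
    pc k' = pc k + csize c /\ Rel s' k' /\ wf s' /\ T' <= B * T.
Proof.
  induction 1 as [s|s x e v E|s ea e a v Ea E Ha|s e v E
    |c1 c2 s T1 s1 T2 s2 _ IH1 _ IH2|g c1 c2 s f T s' E _ IH|g c s E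
    |g c s T1 s1 T2 s2 E _ IH1 _ IH2];
    intros k Hat HR W Hx HB; cbn [comp csize cmd_vars] in *.
  - exists 0, k. cbn. repeat split; try apply HR; try apply W; lia.
  - apply andb_prop in Hx as [Hx1 Hx2]. apply Nat.ltb_lt in Hx1.
    apply code_at_app in Hat as [Hat1 Hat2].
    destruct (cexp_correct prog s e W v 0 k E Hx2 Hat1 HR)
      as (k1 & S1 & P1 & (R1 & R2 & R3 & R4) & V1 & F1).
    rewrite <- P1 in Hat2. pose proof (ev_lt _ _ _ W E) as Hv.
    exists (length (cexp 0 e) + 1). eexists. split.
    { rewrite (steps_app _ _ _ _ _ S1).
      eapply steps_one; [eassumption|reflexivity]. }
    cbn [pc]. split; [lia|]. split; [|split; [apply wf_set; auto|lia]].
    unfold Rel; cbn [reg mem out top set store emit env smem sout].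
    repeat split; auto.
    intros y Hy. unfold upd, eval_binop.
    rewrite V1, Nat.lor_diag, Nat.mod_small by auto.
    destruct (y =? x); auto.
  - destruct (two_exps prog s ea e a v k _ W Ea E Hx Hat HR)
      as (k1 & S1 & P1 & (R1 & R2 & R3 & R4) & V1 & V2 & Hat1).
    pose proof (ev_lt _ _ _ W E) as Hv.
    exists (length (cexp 0 ea) + length (cexp 1 e) + 1). eexists. split.
    { rewrite (steps_app _ _ _ _ _ S1).
      eapply steps_one; [eassumption|reflexivity]. }
    cbn [pc]. split; [lia|]. split; [|split; [apply wf_store; auto|lia]].
    unfold Rel; cbn [reg mem out top set store emit env smem sout].
    rewrite V1, V2, R2. repeat split; auto. lia.
  - apply code_at_app in Hat as [Hat1 Hat2].
    destruct (cexp_correct prog s e W v 0 k E Hx Hat1 HR)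
      as (k1 & S1 & P1 & (R1 & R2 & R3 & R4) & V1 & F1).
    rewrite <- P1 in Hat2.
    exists (length (cexp 0 e) + 1). eexists. split.
    { rewrite (steps_app _ _ _ _ _ S1).
      eapply steps_one; [eassumption|reflexivity]. }
    cbn [pc]. split; [lia|]. split; [|split; [exact W|lia]].
    unfold Rel; cbn [reg mem out top set store emit env smem sout].
    rewrite V1, R3. repeat split; auto.
  - apply andb_prop in Hx as [Hx1 Hx2]. apply code_at_app in Hat as [Hat1 Hat2].
    rewrite csize_eq in Hat2.
    destruct (IH1 k Hat1 HR W Hx1 ltac:(lia))
      as (T1' & k1 & S1 & P1 & R1 & W1 & B1).
    rewrite <- P1 in Hat2.
    destruct (IH2 k1 Hat2 R1 W1 Hx2 ltac:(lia))
      as (T2' & k2 & S2 & P2 & R2 & W2 & B2).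
    exists (T1' + T2'), k2. rewrite (steps_app _ _ _ _ _ S1).
    repeat split; try apply R2; try apply W2; auto; lia.
  - apply andb_prop in Hx as [Hxg Hx]. apply andb_prop in Hx as [Hx1 Hx2].
    apply code_at_app in Hat as [Hat1 Hat2].
    destruct (ccond_correct prog s g f _ k W E Hxg Hat1 HR)
      as (k1 & S1 & P1 & R1).
    rewrite gsize_eq in Hat2. apply code_at_app in Hat2 as [Hat2 Hat3].
    rewrite csize_eq in Hat3. apply code_at_app in Hat3 as [Hat3 Hat4].
    destruct f.
    + replace (pc k + gsize g + csize c2 + length [Jump
        (pc k + gsize g + csize c2 + 1 + csize c1)]) with (pc k1) in Hat4
        by (cbn; lia).
      rewrite <- P1 in Hat4.
      destruct (IH k1 Hat4 R1 W Hx1 ltac:(lia))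
        as (T2 & k2 & S2 & P2 & R2 & W2 & B2).
      exists (gsize g + T2), k2. rewrite (steps_app _ _ _ _ _ S1).
      repeat split; try apply R2; try apply W2; auto; lia.
    + rewrite <- P1 in Hat2, Hat3.
      destruct (IH k1 Hat2 R1 W Hx2 ltac:(lia))
        as (T2 & k2 & S2 & P2 & R2 & W2 & B2).
      rewrite <- P2 in Hat3.
      exists (gsize g + (T2 + 1)). eexists.
      rewrite (steps_app _ _ _ _ _ S1), (steps_app _ _ _ _ _ S2).
      split; [eapply steps_one; [eassumption|reflexivity]|].
      cbn [pc]. repeat split; try apply R2; try apply W2; auto; lia.
  - apply andb_prop in Hx as [Hxg Hx]. apply code_at_app in Hat as [Hat1 Hat2].
    destruct (ccond_correct prog s g _ _ k W E Hxg Hat1 HR)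
      as (k1 & S1 & P1 & R1).
    rewrite gsize_eq in Hat2. apply code_at_app in Hat2 as [Hat2 _].
    rewrite <- P1 in Hat2.
    exists (gsize g + 1). eexists. rewrite (steps_app _ _ _ _ _ S1).
    split; [eapply steps_one; [eassumption|reflexivity]|].
    cbn [pc]. repeat split; try apply R1; try apply W; auto; lia.
  - apply andb_prop in Hx as [Hxg Hx]. pose proof Hat as Hat0.
    apply code_at_app in Hat as [Hat1 Hat2].
    destruct (ccond_correct prog s g _ _ k W E Hxg Hat1 HR)
      as (k1 & S1 & P1 & R1).
    rewrite gsize_eq in Hat2. apply code_at_app in Hat2 as [_ Hat2].
    apply code_at_app in Hat2 as [Hat2 Hat3]. cbn [length] in Hat2, Hat3.
    rewrite csize_eq in Hat3. rewrite <- P1 in Hat2, Hat3.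
    destruct (IH1 k1 Hat2 R1 W Hx ltac:(lia))
      as (T1' & k2 & S2 & P2 & R2 & W2 & B2).
    rewrite <- P2 in Hat3.
    (* The backward jump returns to the start of the same loop, where [Hat0] applies once more. *)
    set (k3 := Config (pc k) (reg k2) (mem k2) (top k2) (out k2)).
    destruct (IH2 k3 Hat0 R2 W2 ltac:(cbn; rewrite Hxg, Hx; auto) HB)
      as (T2' & k4 & S4 & P4 & R4 & W4 & B4).
    exists (gsize g + (T1' + (1 + T2'))), k4.
    rewrite (steps_app _ _ _ _ _ S1), (steps_app _ _ _ _ _ S2).
    rewrite (steps_app _ _ _ _ k3);
      [|eapply steps_one; [eassumption|reflexivity]].
    repeat split; try apply R4; try apply W4; auto; lia.
Qed.

End Semantics.

(** * Packed blocks of characters *)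

Lemma pow2_pos k : 0 < 2 ^ k.
Proof. apply Nat.neq_0_lt_0, Nat.pow_nonzero; lia. Qed.

(** Little-endian, so dropping leading characters is a division and truncation a reduction modulo a
    power of 2. A total [f] covers reads past the end of a string. *)
Fixpoint code (b : nat) (f : nat -> nat) (a l : nat) : nat :=
  match l with
  | 0 => 0
  | S l' => f a + 2 ^ b * code b f (S a) l'
  end.

Section Code.

Variables (b : nat).

Lemma code_ext f g a a' l :
  (forall k, k < l -> f (a + k) = g (a' + k)) -> code b f a l = code b g a' l.
Proof.
  revert a a'; induction l as [|l IH]; intros a a' H; cbn; auto.
  rewrite (IH (S a) (S a')).
  - specialize (H 0 ltac:(lia)). rewrite !Nat.add_0_r in H. lia.
  - intros k Hk. specialize (H (S k) ltac:(lia)).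
    rewrite <- !plus_n_Sm in H. exact H.
Qed.

Lemma code_app f a l1 l2 :
  code b f a (l1 + l2) = code b f a l1 + 2 ^ (l1 * b) * code b f (a + l1) l2.
Proof.
  revert a; induction l1 as [|l1 IH]; intros a; cbn [code Nat.add Nat.mul].
  - rewrite Nat.add_0_r, Nat.pow_0_r; lia.
  - rewrite IH, Nat.pow_add_r, <- plus_n_Sm. cbn. ring.
Qed.

Lemma code_lt f a l : (forall x, f x < 2 ^ b) -> code b f a l < 2 ^ (l * b).
Proof.
  intros H; revert a; induction l as [|l IH]; intros a; cbn [code Nat.mul].
  - cbn; lia.
  - rewrite Nat.pow_add_r. specialize (IH (S a)). specialize (H a).
    pose proof (Nat.mul_le_mono_l _ _ (2 ^ b) IH). lia.
Qed.

Lemma code_mod f a l1 l :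
  (forall x, f x < 2 ^ b) -> l1 <= l ->
  code b f a l mod 2 ^ (l1 * b) = code b f a l1.
Proof.
  intros H Hl. replace l with (l1 + (l - l1)) by lia.
  rewrite code_app, (Nat.mul_comm (2 ^ _)), Nat.Div0.mod_add.
  apply Nat.mod_small, code_lt; auto.
Qed.

Lemma code_div f a l1 l :
  (forall x, f x < 2 ^ b) -> l1 <= l ->
  code b f a l / 2 ^ (l1 * b) = code b f (a + l1) (l - l1).
Proof.
  intros H Hl. replace l with (l1 + (l - l1)) at 1 by lia.
  rewrite code_app, (Nat.mul_comm (2 ^ _)), Nat.div_add
    by (apply Nat.pow_nonzero; lia).
  rewrite Nat.div_small by (apply code_lt; auto). lia.
Qed.

(** Division and reduction recover each single character from the code. *)
Lemma code_inj f g a a' l :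
  (forall x, f x < 2 ^ b) -> (forall x, g x < 2 ^ b) ->
  code b f a l = code b g a' l -> forall k, k < l -> f (a + k) = g (a' + k).
Proof.
  intros Hf Hg E k Hk.
  assert (G : forall h c, (forall x, h x < 2 ^ b) ->
    (code b h c l / 2 ^ (k * b)) mod 2 ^ b = h (c + k)).
  { intros h c Hh. rewrite code_div by (auto; lia).
    replace (2 ^ b) with (2 ^ (1 * b)) by (f_equal; lia).
    rewrite code_mod by (auto; lia). cbn; lia. }
  rewrite <- (G f a Hf), <- (G g a' Hg), E; auto.
Qed.

Lemma code_eq_iff f g a a' l :
  (forall x, f x < 2 ^ b) -> (forall x, g x < 2 ^ b) ->
  code b f a l = code b g a' l <-> forall k, k < l -> f (a + k) = g (a' + k).
Proof.
  intros Hf Hg; split; [apply code_inj; auto | apply code_ext].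
Qed.

Lemma code_zero f a l : (forall k, k < l -> f (a + k) = 0) -> code b f a l = 0.
Proof.
  revert a; induction l as [|l IH]; intros a H; cbn; auto.
  rewrite IH.
  - specialize (H 0 ltac:(lia)). rewrite Nat.add_0_r in H. lia.
  - intros k Hk. specialize (H (S k) ltac:(lia)).
    rewrite <- plus_n_Sm in H. exact H.
Qed.

Lemma pack_word_code l f a :
  (forall k, nth k l 0 = f (a + k)) -> forall q, length l <= q ->
  pack_word b l = code b f a q.
Proof.
  revert a; induction l as [|x l IH]; intros a H q Hq; cbn.
  - symmetry; apply code_zero. intros k _. rewrite <- H. destruct k; auto.
  - cbn in Hq. destruct q as [|q]; [lia|]. cbn.
    rewrite <- (IH (S a)); [| |lia].
    + f_equal. specialize (H 0). rewrite Nat.add_0_r in H; auto.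
    + intros k. specialize (H (S k)). rewrite <- plus_n_Sm in H. exact H.
Qed.

(** No bound on [y] is required: missing words and the unfilled part of the last word agree with the
    default [0] of [nth]. *)
Lemma pack_nth q l y : 0 < q ->
  nth y (pack q b l) 0 = code b (fun x => nth x l 0) (y * q) q.
Proof.
  intros Hq. unfold pack.
  set (L := (length l + (q - 1)) / q).
  assert (HL : length l <= L * q).
  { unfold L. pose proof (Nat.div_mod_eq (length l + (q - 1)) q).
    pose proof (Nat.mod_upper_bound (length l + (q - 1)) q). lia. }
  destruct (Nat.lt_ge_cases y L) as [Hy|Hy].
  - rewrite (nth_indep _ 0 (pack_word b (firstn q (skipn (0 * q) l))))
      by (rewrite length_map, length_seq; auto).
    rewrite (map_nth (fun i => pack_word b (firstn q (skipn (i * q) l)))).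
    rewrite seq_nth by auto. rewrite Nat.add_0_l.
    erewrite <- (code_ext (fun k => if k - y * q <? q then nth k l 0 else 0)
                          _ (y * q) (y * q) q).
    + apply pack_word_code; [|rewrite length_firstn; lia].
      intros k. rewrite nth_firstn, nth_skipn.
      replace (y * q + k - y * q) with k by lia. auto.
    + intros k Hk. replace (y * q + k - y * q) with k by lia.
      destruct (Nat.ltb_spec k q); [auto|lia].
  - rewrite nth_overflow by (rewrite length_map, length_seq; auto).
    symmetry; apply code_zero. intros k Hk. apply nth_overflow.
    pose proof (Nat.mul_le_mono_r _ _ q Hy). lia.
Qed.

(* A block of [l] characters spans at most two words. *)
Lemma block_value w q f x l :
  (forall x, f x < 2 ^ b) -> 0 < q -> q * b <= w -> l <= q ->
  let lo := code b f (x / q * q) q / 2 ^ (x mod q * b) in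
  let hi :=
    (code b f ((x / q + 1) * q) q * 2 ^ ((q - x mod q) * b)) mod 2 ^ w in
  lo + hi < 2 ^ w /\ (lo + hi) mod 2 ^ (l * b) = code b f x l.
Proof.
  intros Hf Hq Hw Hl lo hi.
  pose proof (Nat.mod_upper_bound x q ltac:(lia)) as Hx.
  pose proof (Nat.div_mod_eq x q) as Ex.
  set (d := x mod q) in *. set (y := x / q) in *.
  assert (Elo : lo = code b f x (q - d)).
  { unfold lo. rewrite code_div by (auto; lia). f_equal. lia. }
  assert (Hlo : lo < 2 ^ ((q - d) * b)) by (rewrite Elo; apply code_lt; auto).
  assert (Hle : (q - d) * b <= w) by nia.
  (* [hi] is a multiple of [2^((q - d) b)], even after its top bits are cut off, and [lo] is smaller
     than this power: the sum has no carries and stays below [2^w]. *)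
  assert (Hhi : exists h, hi = h * 2 ^ ((q - d) * b)
                          /\ h < 2 ^ (w - (q - d) * b)).
  { unfold hi.
    replace (2 ^ w) with (2 ^ (w - (q - d) * b) * 2 ^ ((q - d) * b))
      by (rewrite <- Nat.pow_add_r; f_equal; lia).
    rewrite Nat.Div0.mul_mod_distr_r.
    eexists; split; [reflexivity|]. apply Nat.mod_upper_bound.
    apply Nat.pow_nonzero; lia. }
  destruct Hhi as (h & Eh & Hh). split.
  - rewrite Eh. replace (2 ^ w) with (2 ^ (w - (q - d) * b) * 2 ^ ((q - d) * b))
      by (rewrite <- Nat.pow_add_r; f_equal; lia).
    apply (Nat.mul_le_mono_r _ _ (2 ^ ((q - d) * b))) in Hh. lia.
  - assert (Hlw : l * b <= w) by nia.
    (* Cutting at [w] bits does not affect the lowest [l b <= w] bits. *)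
    assert (M : forall z, (z mod 2 ^ w) mod 2 ^ (l * b) = z mod 2 ^ (l * b)).
    { intros z. replace w with (l * b + (w - l * b)) by lia.
      rewrite Nat.pow_add_r, Nat.Div0.mod_mul_r.
      rewrite (Nat.mul_comm (2 ^ (l * b))), Nat.Div0.mod_add.
      apply Nat.Div0.mod_mod. }
    rewrite Nat.Div0.add_mod. unfold hi; rewrite M.
    rewrite <- Nat.Div0.add_mod, Elo.
    replace ((y + 1) * q) with (x + (q - d)) by lia.
    rewrite (Nat.mul_comm _ (2 ^ _)), <- code_app.
    apply code_mod; auto; lia.
Qed.

End Code.

Lemma low_bits w k x : k <= w ->
  Nat.shiftr (Nat.shiftl x (w - k) mod 2 ^ w) (w - k) = x mod 2 ^ k.
Proof.
  intros Hk. rewrite Nat.shiftl_mul_pow2, Nat.shiftr_div_pow2.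
  replace (2 ^ w) with (2 ^ k * 2 ^ (w - k))
    by (rewrite <- Nat.pow_add_r; f_equal; lia).
  rewrite Nat.Div0.mul_mod_distr_r. apply Nat.div_mul, Nat.pow_nonzero; lia.
Qed.

(** * Borders and occurrences *)

Section Borders.

Variable P : list nat.
Local Notation pf x := (nth x P 0).

(** The improper border [l = i] is included; it is the candidate at distance 0, the oldest one. *)
Definition border (l i : nat) : Prop :=
  l <= i /\ forall k, k < l -> pf k = pf (i - l + k).

(** The Knuth-Morris-Pratt failure function, as a relation. *)
Definition isfail (v i : nat) : Prop :=
  v < i /\ border v i /\ forall l, l < i -> border l i -> l <= v.

Lemma border_0 i : border 0 i.
Proof. split; [lia|intros; lia]. Qed.

Lemma border_refl i : border i i.
Proof. split; auto. intros k _. f_equal; lia. Qed.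

Lemma border_trans a b c : border a b -> border b c -> border a c.
Proof.
  intros [H1 H2] [H3 H4]; split; [lia|]. intros k Hk.
  rewrite H2, H4 by lia. f_equal; lia.
Qed.

Lemma border_shorter a b c : a <= b -> border a c -> border b c -> border a b.
Proof.
  intros Hab [H1 H2] [H3 H4]; split; auto. intros k Hk.
  rewrite H2, (H4 (b - a + k)) by lia. f_equal; lia.
Qed.

Lemma border_pred a c : border (S a) (S c) -> border a c.
Proof.
  intros [H1 H2]; split; [lia|]. intros k Hk. rewrite H2 by lia. f_equal; lia.
Qed.

Lemma border_last a c : border (S a) (S c) -> pf a = pf c.
Proof. intros [H1 H2]. rewrite (H2 a) by lia. f_equal; lia. Qed.

Lemma border_succ a c : border a c -> pf a = pf c -> border (S a) (S c).
Proof.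
  intros [H1 H2] E; split; [lia|]. intros k Hk.
  destruct (Nat.eq_dec k a) as [->|Hka].
  - rewrite E; f_equal; lia.
  - rewrite H2 by lia. f_equal; lia.
Qed.

End Borders.

Section Strings.

Variables (P Q : list nat).
Let m := length P.
Let n := length Q.
Local Notation pf x := (nth x P 0).
Local Notation qf x := (nth x Q 0).

(* The prefix of length [i] of [P] ends at position [j] of [Q]. *)
Definition match_at (i j : nat) : Prop :=
  i <= j /\ forall k, k < i -> pf k = qf (j - i + k).

Definition Occ (u : nat) : Prop :=
  u + m <= n /\ forall k, k < m -> pf k = qf (u + k).

(** Progress is measured by starts, while the output lists ends. [NoDup] gives the final permutation
    and bounds the number of outputs by [occ]. *)
Definition reported (d : nat) (o : list nat) : Prop :=
  NoDup o /\ forall k, In k o <-> exists u, u < d /\ k = u + m /\ Occ u.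

Lemma match_border l i j : match_at i j -> border P l i -> match_at l j.
Proof.
  intros [H1 H2] [H3 H4]; split; [lia|]. intros k Hk.
  rewrite H4, H2 by lia. f_equal; lia.
Qed.

Lemma match_0 j : match_at 0 j.
Proof. split; [lia|intros; lia]. Qed.

Lemma match_succ i j : match_at i j -> pf i = qf j -> match_at (S i) (S j).
Proof.
  intros [H1 H2] E; split; [lia|]. intros k Hk.
  destruct (Nat.eq_dec k i) as [->|Hki].
  - rewrite E; f_equal; lia.
  - rewrite H2 by lia. f_equal; lia.
Qed.

Lemma match_extend i j r :
  match_at i j -> (forall k, k < r -> pf (i + k) = qf (j + k)) ->
  match_at (i + r) (j + r).
Proof.
  intros [H1 H2] H; split; [lia|]. intros k Hk.
  destruct (Nat.lt_ge_cases k i) as [Hki|Hki].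
  - rewrite H2 by lia. f_equal; lia.
  - replace k with (i + (k - i)) by lia. rewrite H by lia. f_equal; lia.
Qed.

(** The text between [u] and [j] is a prefix of the occurrence and at the same time a suffix of the
    matched prefix [P[0,i)]. *)
Lemma occ_border i j u :
  match_at i j -> i <= m -> Occ u -> j - i <= u -> u <= j -> border P (j - u) i.
Proof.
  intros [H1 H2] Hi [H3 H4] Hu Huj; split; [lia|]. intros k Hk.
  rewrite H4 by lia. rewrite H2 by lia. f_equal; lia.
Qed.

(** Otherwise the overlap would be a proper border of [P[0,i)] longer than [v]. *)
Lemma occ_skip i v j u :
  match_at i j -> i <= m -> isfail P v i -> j - i < u -> u < j - v -> ~ Occ u.
Proof.
  intros HM Hi (H1 & H2 & H3) Hu Huj HO. pose proof HM as [Hij _].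
  assert (B : border P (j - u) i) by (eapply occ_border; eauto; lia).
  apply H3 in B; lia.
Qed.

Lemma occ_mismatch i j :
  match_at i j -> i < m -> pf i <> qf j -> ~ Occ (j - i).
Proof.
  intros [H1 H2] Hi E [_ HO]. apply E. rewrite HO by auto. f_equal; lia.
Qed.

Lemma reported_extend d d' o :
  reported d o -> d <= d' -> (forall u, d <= u -> u < d' -> ~ Occ u) ->
  reported d' o.
Proof.
  intros [H1 H2] Hd HO; split; auto. intros k; rewrite H2; split.
  - intros (u & Hu & E & Ho); exists u; repeat split; try apply Ho; auto; lia.
  - intros (u & Hu & E & Ho). exists u; repeat split; try apply Ho; auto.
    destruct (Nat.lt_ge_cases u d); auto. exfalso; eapply HO; eauto.
Qed.

Lemma reported_app d d' o l :
  reported d o -> d <= d' -> NoDup l ->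
  (forall k, In k l <-> exists u, d <= u /\ u < d' /\ k = u + m /\ Occ u) ->
  reported d' (o ++ l).
Proof.
  intros [H1 H2] Hd Hl HO; split.
  - apply NoDup_app; auto. intros k Hk Hk'.
    apply H2 in Hk as (u & ? & ? & _). apply HO in Hk' as (u' & ? & ? & ? & _).
    lia.
  - intros k; rewrite in_app_iff, H2, HO; split.
    + intros [(u & Hu & E & Ho)|(u & Hu & Hu' & E & Ho)];
        exists u; repeat split; try apply Ho; auto; lia.
    + intros (u & Hu & E & Ho).
      destruct (Nat.lt_ge_cases u d); [left|right]; exists u; auto.
Qed.

Lemma reported_0 : reported 0 [].
Proof.
  split; [constructor|]. intros k; split; [intros []|].
  intros (u & Hu & _); lia.
Qed.

Lemma firstn_skipn_eq u :
  u + m <= n ->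
  firstn m (skipn u Q) = P <-> forall k, k < m -> pf k = qf (u + k).
Proof.
  intros Hu; split.
  - intros E k Hk.
    assert (F : nth k (firstn m (skipn u Q)) 0 = nth k P 0)
      by (rewrite E; auto).
    rewrite nth_firstn, nth_skipn, (proj2 (Nat.ltb_lt _ _) Hk) in F.
    symmetry; exact F.
  - intros H. apply nth_ext with (d := 0) (d' := 0).
    + rewrite length_firstn, length_skipn. fold m n. lia.
    + rewrite length_firstn, length_skipn. fold m n. intros k Hk.
      rewrite nth_firstn, nth_skipn.
      assert (Hkm : k < m) by lia. rewrite (proj2 (Nat.ltb_lt _ _) Hkm).
      symmetry; apply H; auto.
Qed.

Lemma in_occurrences k :
  In k (occurrences P Q) <-> 1 <= k /\ exists u, k = u + m /\ Occ u.
Proof.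
  unfold occurrences. fold m n. rewrite filter_In, in_seq, Bool.andb_true_iff.
  rewrite Nat.leb_le. split.
  - intros (Hk & Hm & E). split; [lia|]. exists (k - m). split; [lia|].
    destruct list_eq_dec as [E'|]; [|discriminate].
    split; [lia|]. apply firstn_skipn_eq; auto; lia.
  - intros (Hk & u & -> & Hu & HO). repeat split; try lia.
    destruct list_eq_dec as [E'|E']; auto. exfalso; apply E'.
    apply firstn_skipn_eq; replace (u + m - m) with u by lia; auto.
Qed.

Lemma nodup_occurrences : NoDup (occurrences P Q).
Proof. apply NoDup_filter, seq_NoDup. Qed.

(** This lets the number of outputs still to come act as a potential. For [m = 0] the end position 0
    could be in [o], although it is not listed by [occurrences]. *)
Lemma reported_length d o : 1 <= m -> reported d o -> length o <= occ P Q.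
Proof.
  intros Hm [H1 H2]. apply NoDup_incl_length; auto.
  intros k Hk. apply H2 in Hk as (u & _ & -> & HO).
  apply in_occurrences. split; [lia|]. eauto.
Qed.

Lemma reported_all d o :
  1 <= m -> reported d o -> n < d + m -> Permutation o (occurrences P Q).
Proof.
  intros Hm [H1 H2] Hd. apply NoDup_Permutation; auto using nodup_occurrences.
  intros k; rewrite H2, in_occurrences; split.
  - intros (u & _ & -> & HO). split; [lia|eauto].
  - intros (_ & u & -> & HO). exists u; repeat split; try apply HO.
    destruct HO; lia.
Qed.

End Strings.

(** * The matching program *)

(* The block length is [vr], with [vN = 2^(r b)] codes of blocks.  The base
   addresses are those of the border masks ([vK]), of the lowest and the highest
   bits of small numbers ([vL], [vH]), and of the tables for the predicates [pG],
   [pE] and [pX] below.  The failure function is at the addresses [1..m]. *)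

Notation vm := 0 (only parsing).
Notation vn := 1 (only parsing).
Notation vb := 2 (only parsing).
Notation vq := 3 (only parsing).
Notation vw := 4 (only parsing).
Notation vt := 5 (only parsing).
Notation vr := 6 (only parsing).
Notation vrb := 7 (only parsing).
Notation vN := 8 (only parsing).
Notation vr1 := 9 (only parsing).
Notation vK := 10 (only parsing).
Notation vL := 11 (only parsing).
Notation vH := 12 (only parsing).
Notation vG := 13 (only parsing).
Notation vE := 14 (only parsing).
Notation vX := 15 (only parsing).
Notation vO := 16 (only parsing).
Notation vN2 := 17 (only parsing).
Notation vN3 := 18 (only parsing).
Notation vi := 20 (only parsing).
Notation vj := 21 (only parsing).
Notation vu := 22 (only parsing).
Notation vB := 23 (only parsing).
Notation vx := 24 (only parsing).
Notation vc := 25 (only parsing).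
Notation vf := 26 (only parsing).
Notation vg := 27 (only parsing).
Notation ve := 28 (only parsing).
Notation vV := 29 (only parsing).
Notation vy := 30 (only parsing).
Notation vz := 31 (only parsing).

Notation "a +: b" := (Op Add a b) (at level 50, left associativity).
Notation "a -: b" := (Op Sub a b) (at level 50, left associativity).
Notation "a *: b" := (Op Mul a b) (at level 40, left associativity).
Notation "a <<: b" := (Op Shl a b) (at level 55, left associativity).
Notation "a >>: b" := (Op Shr a b) (at level 55, left associativity).
Notation "a ;; b" := (Seq a b) (at level 80, right associativity).
Notation "x ::= e" := (Assign x e) (at level 70).

(* The [k] low bits of [e]; also correct for [k = w], unlike a mask [2^k - 1]
   obtained by a shift. *)
Definition elow (e k : expr) : expr :=
  (e <<: (Var vw -: k)) >>: (Var vw -: k).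

Definition eblk (word : expr -> expr) (x lb : expr) : expr :=
  let d := Op Mod x (Var vq) in
  let y := Op Div x (Var vq) in
  elow ((word y >>: (d *: Var vb)) +:
        (word (y +: Cst 1) <<: ((Var vq -: d) *: Var vb))) lb.

Definition echar (word : expr -> expr) (x : expr) : expr :=
  eblk word x (Var vb).

(** A completed match is reported and at once replaced by its longest proper border, so [i < m]
    holds at every test. *)
Definition naive : cmd :=
  While (CLt (Var vj) (Var vn))
    (If (CEq (echar PWord (Var vi)) (echar QWord (Var vj)))
      (vi ::= Var vi +: Cst 1 ;;
       vj ::= Var vj +: Cst 1 ;;
       If (CEq (Var vi) (Var vm))
         (Out (Var vj) ;; vi ::= Mem (Var vi))
         Skip)
      (If (CEq (Var vi) (Cst 0))
        (vj ::= Var vj +: Cst 1)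
        (vi ::= Mem (Var vi)))).

Definition failure : cmd :=
  vi ::= Cst 0 ;; vj ::= Cst 1 ;; Store (Cst 1) (Cst 0) ;;
  While (CLt (Var vj) (Var vm))
    (If (CEq (echar PWord (Var vi)) (echar PWord (Var vj)))
      (vi ::= Var vi +: Cst 1 ;;
       vj ::= Var vj +: Cst 1 ;;
       Store (Var vj) (Var vi))
      (If (CEq (Var vi) (Cst 0))
        (vj ::= Var vj +: Cst 1 ;; Store (Var vj) (Cst 0))
        (vi ::= Mem (Var vi)))).

(** Eight shifts, since the number [8 b] itself need not fit in a short word. *)
Definition shift8 (e : expr) : expr :=
  e >>: Var vb >>: Var vb >>: Var vb >>: Var vb
    >>: Var vb >>: Var vb >>: Var vb >>: Var vb.

(* [r = min (floor (log2 t / (8 b))) (q / 2)], so that [vN ^ 8 <= t]. *)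
Definition choose_r : cmd :=
  vr ::= Cst 0 ;; vu ::= shift8 (Var vt) ;;
  While (CLt (Cst 0) (Var vu))
    (vr ::= Var vr +: Cst 1 ;; vu ::= shift8 (Var vu)) ;;
  If (CLt (Var vq >>: Cst 1) (Var vr)) (vr ::= Var vq >>: Cst 1) Skip.

(** [vO] has the bits from [m + 1] on: an occurrence ending at an offset [x > m] of a block lies
    inside the block and needs no earlier candidate. *)
Definition setup : cmd :=
  vrb ::= Var vr *: Var vb ;;
  vN ::= Cst 1 <<: Var vrb ;;
  vr1 ::= Var vr +: Cst 1 ;;
  vK ::= Var vm +: Cst 1 ;;
  vL ::= Var vK +: Var vK ;;
  vN2 ::= Var vN +: Var vN ;;
  vH ::= Var vL +: Var vN2 ;;
  vG ::= Var vH +: Var vN2 ;;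
  vE ::= Var vG +: Var vN ;;
  vX ::= Var vE +: Var vN ;;
  vO ::= ((Cst 1 <<: Var vr1) -: Cst 1) <<: Var vK ;;
  vN3 ::= Var vN *: Var vN *: Var vN.

(** The proper borders of [P[0,i)] are the borders of the longest one, [P[0,u)], at distances larger
    by [i - u]. So the mask of [i] is a shifted mask of [u] with bit 0 added. *)
Definition masks_loop : cmd :=
  Store (Var vK) (Cst 1) ;; vi ::= Cst 1 ;;
  While (CLt (Var vi) (Var vm))
    (vu ::= Mem (Var vi) ;;
     Store (Var vK +: Var vi)
       (Op Or (Cst 1)
         (elow (Mem (Var vK +: Var vu) <<: (Var vi -: Var vu)) (Var vr1))) ;;
     vi ::= Var vi +: Cst 1).

(** The instruction set has no bit scan; both entries for [y] follow from those for [y / 2]. *)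
Definition logs_loop : cmd :=
  Store (Var vL +: Cst 1) (Cst 0) ;; Store (Var vH +: Cst 1) (Cst 0) ;;
  vy ::= Cst 2 ;;
  While (CLt (Var vy) (Var vN2))
    (Store (Var vH +: Var vy) (Mem (Var vH +: (Var vy >>: Cst 1)) +: Cst 1) ;;
     If (CEq (Op Mod (Var vy) (Cst 2)) (Cst 0))
       (Store (Var vL +: Var vy) (Mem (Var vL +: (Var vy >>: Cst 1)) +: Cst 1))
       (Store (Var vL +: Var vy) (Cst 0)) ;;
     vy ::= Var vy +: Cst 1).

(** A test [chk] expresses its predicate as the equality of [vf] and [vg], so one loop builds all
    three tables. *)
Definition table (base size : nat) (chk : cmd) : cmd :=
  vB ::= Cst 0 ;;
  While (CLt (Var vB) (Var size))
    (vc ::= Cst 0 ;; vx ::= Cst 0 ;;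
     While (CLt (Var vx) (Var vr1))
       (chk ;;
        If (CEq (Var vf) (Var vg))
          (vc ::= Op Or (Var vc) (Cst 1 <<: Var vx)) Skip ;;
        vx ::= Var vx +: Cst 1) ;;
     Store (Var base +: Var vB) (Var vc) ;;
     vB ::= Var vB +: Cst 1).

(** No quotient of a block code reaches [N], so this value makes the test fail for [x >= m]. *)
Definition chkG : cmd :=
  vf ::= Var vB >>: ((Var vr -: Var vx) *: Var vb) ;;
  If (CLt (Var vx) (Var vm))
    (vg ::= eblk PWord (Cst 0) (Var vx *: Var vb)) (vg ::= Var vN).

Definition chkE : cmd :=
  vz ::= Var vx ;;
  If (CLt (Var vm) (Var vx)) (vz ::= Var vm) Skip ;;
  vf ::= elow (Var vB) (Var vx *: Var vb) >>: ((Var vx -: Var vz) *: Var vb) ;;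
  vg ::= eblk PWord (Var vm -: Var vz) (Var vz *: Var vb).

Definition chkX : cmd :=
  vf ::= elow (Var vB >>: Var vrb >>: ((Var vr -: Var vx) *: Var vb))
              (Var vrb) ;;
  vg ::= elow (Var vB) (Var vrb).

Definition report_loop : cmd :=
  While (CLt (Cst 0) (Var ve))
    (vx ::= Mem (Var vL +: Var ve) ;;
     Out (Var vj +: Var vx) ;;
     ve ::= Op Xor (Var ve) (Cst 1 <<: Var vx)).

Definition transition : cmd :=
  If (CEq (Var vy) (Cst 0))
    (If (CLt (Var vr) (Var vi))
      (vi ::= Mem (Var vi -: Mem (Var vH +: Mem (Var vK +: Var vi))))
      (vi ::= Mem (Var vH +: Mem (Var vG +: Var vB)) ;;
       vj ::= Var vj +: Var vr))
    (vi ::= Var vi +: Var vr -: Mem (Var vL +: Var vy) ;;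
     vj ::= Var vj +: Var vr).

(** An occurrence ending at offset [x <= m] continues the candidate at distance [x - (m - i)], hence
    the shift of the mask by [m - i]. For [i <= r] the window cannot begin at [i - r]; it begins at
    0, and the shift by [r - i] realigns the answer. Past its end [P] reads as 0, which is a letter
    too, so candidates with [i - d + r >= m], already decided by the reports, are cleared from the
    low end of [vy]. *)
Definition block_step : cmd :=
  vB ::= eblk QWord (Var vj) (Var vrb) ;;
  ve ::= Op And (Mem (Var vE +: Var vB))
           (Op Or (Mem (Var vK +: Var vi) <<: (Var vm -: Var vi)) (Var vO)) ;;
  report_loop ;;
  If (CLt (Var vr) (Var vi))
    (vV ::= eblk PWord (Var vi -: Var vr) (Var vrb +: Var vrb) ;; vu ::= Cst 0)
    (vV ::= eblk PWord (Cst 0) (Var vrb +: Var vrb) ;;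
     vu ::= Var vr -: Var vi) ;;
  vy ::= Op And (Mem (Var vX +: (Var vV *: Var vN +: Var vB)) >>: Var vu)
           (Mem (Var vK +: Var vi)) ;;
  If (CLt (Var vi +: Var vr) (Var vm)) Skip
    (vu ::= Var vi +: Var vr +: Cst 1 -: Var vm ;;
     vy ::= (Var vy >>: Var vu) <<: Var vu) ;;
  transition.

(** The test means [j + r <= n], without the sum, which may overflow. *)
Definition blocks : cmd :=
  While (CLt (Var vr -: Cst 1) (Var vn -: Var vj)) block_step.

Definition fast : cmd :=
  setup ;; masks_loop ;; logs_loop ;;
  table vG vN chkG ;; table vE vN chkE ;; table vX vN3 chkX ;;
  vi ::= Cst 0 ;; vj ::= Cst 0 ;; blocks.

(** The test for [n < 4 m] shifts [n], because [4 m] may overflow. After [fast] the final [naive]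
    only has fewer than [r] characters left. *)
Definition main : cmd :=
  If (CLt (Var vn) (Var vm)) Skip
    (If (CEq (Var vm) (Cst 0))
      (vj ::= Cst 0 ;;
       While (CLt (Var vj) (Var vn)) (vj ::= Var vj +: Cst 1 ;; Out (Var vj)))
      (failure ;; choose_r ;; vi ::= Cst 0 ;; vj ::= Cst 0 ;;
       If (CLt (Var vn >>: Cst 1 >>: Cst 1) (Var vm)) Skip
         (If (CEq (Var vr) (Cst 0)) Skip fast) ;;
       naive)).

(** * Correctness and cost of the matching program *)

Definition par (l : list nat) (s : state) : Prop :=
  forall x, x < length l -> env s x = nth x l 0.

Lemma par_set l x v s : length l <= x -> par l s -> par l (set x v s).
Proof.
  intros Hx H y Hy. cbn. unfold upd. destruct (Nat.eqb_spec y x); [lia|auto].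
Qed.

Section Verification.

Variables (w b q t A : nat) (P Q : list nat).
Let m := length P.
Let n := length Q.
Let pf x := nth x P 0.
Let qf x := nth x Q 0.

Hypothesis q_pos : 1 <= q.
Hypothesis b_pos : 1 <= b.
Hypothesis qb_le : q * b <= w.
Hypothesis pf_lt : forall x, pf x < 2 ^ b.
Hypothesis qf_lt : forall x, qf x < 2 ^ b.
Hypothesis m_pos : 1 <= m.
Hypothesis mn : m <= n.
Hypothesis nw : n < 2 ^ w.
Hypothesis t2 : 2 <= t.
Hypothesis tw : t < 2 ^ w.
Hypothesis mA : m < A.

Definition L6 : list nat := [m; n; b; q; w; t].

Notation evs := (ev w (pack q b P) (pack q b Q) A).
Notation wps := (wp w (pack q b P) (pack q b Q) A).

Lemma w_lt : w < 2 ^ w.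
Proof. apply Nat.pow_gt_lin_r; lia. Qed.

Lemma w_pos : 2 <= w.
Proof.
  destruct w as [|[|k]]; [cbn in tw; lia|cbn in tw; lia|lia].
Qed.

Lemma ev_low s e k x y :
  env s vw = w -> evs s e x -> evs s k y -> y <= w ->
  evs s (elow e k) (x mod 2 ^ y).
Proof.
  intros Hw He Hk Hy. unfold elow. rewrite <- (low_bits w y x Hy).
  repeat (constructor; auto).
Qed.

Lemma ev_block_aux word l s ex el x k :
  (forall e y, evs s e y -> evs s (word e) (nth y (pack q b l) 0)) ->
  (forall x, nth x l 0 < 2 ^ b) ->
  env s vb = b -> env s vq = q -> env s vw = w ->
  evs s ex x -> x + 1 < 2 ^ w -> evs s el (k * b) -> k <= q ->
  evs s (eblk word ex el) (code b (fun x => nth x l 0) x k).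
Proof.
  intros Hword Hl Eb Eq Ew Ex Hx Ek Hk.
  pose proof w_lt. pose proof w_pos.
  assert (Hd : x mod q < q) by (apply Nat.mod_upper_bound; lia).
  assert (Hy : x / q <= x) by (apply Nat.Div0.div_le_upper_bound; nia).
  destruct (block_value b w q (fun x => nth x l 0) x k Hl q_pos qb_le Hk)
    as [B1 B2].
  rewrite <- B2. unfold eblk.
  apply ev_low; auto; [|nia].
  rewrite <- !pack_nth in * by lia.
  rewrite <- Nat.shiftr_div_pow2, <- Nat.shiftl_mul_pow2 in *.
  apply ev_add; auto.
  - apply ev_shr; [apply Hword|]; repeat (constructor; auto); nia.
  - apply ev_shl; [apply Hword|]; repeat (constructor; auto); nia.
Qed.

Lemma ev_blockP s ex el x k :
  env s vb = b -> env s vq = q -> env s vw = w ->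
  evs s ex x -> x + 1 < 2 ^ w -> evs s el (k * b) -> k <= q ->
  evs s (eblk PWord ex el) (code b pf x k).
Proof. apply ev_block_aux; auto. intros; constructor; auto. Qed.

Lemma ev_blockQ s ex el x k :
  env s vb = b -> env s vq = q -> env s vw = w ->
  evs s ex x -> x + 1 < 2 ^ w -> evs s el (k * b) -> k <= q ->
  evs s (eblk QWord ex el) (code b qf x k).
Proof. apply ev_block_aux; auto. intros; constructor; auto. Qed.

Lemma ev_charP s ex x :
  env s vb = b -> env s vq = q -> env s vw = w ->
  evs s ex x -> x + 1 < 2 ^ w -> evs s (echar PWord ex) (pf x).
Proof.
  intros. replace (pf x) with (code b pf x 1) by (cbn; lia).
  apply ev_blockP; auto. constructor; lia.
Qed.

Lemma ev_charQ s ex x :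
  env s vb = b -> env s vq = q -> env s vw = w ->
  evs s ex x -> x + 1 < 2 ^ w -> evs s (echar QWord ex) (qf x).
Proof.
  intros. replace (qf x) with (code b qf x 1) by (cbn; lia).
  apply ev_blockQ; auto. constructor; lia.
Qed.

Ltac st := cbn [env smem sout set store emit upd Nat.eqb].

Ltac env_tac :=
  st;
  first [ eassumption
        | match goal with H : par ?l ?s |- env ?s ?x = _ =>
            let E := fresh in
            let l' := eval red in l in
            pose proof (H x ltac:(cbn; lia)) as E;
            change l with l' in E; cbn [nth] in E; exact E end
        | reflexivity ].

Ltac ev_tac :=
  lazymatch goal with
  | |- ev _ _ _ _ _ ?e _ =>
    lazymatch e with
    | elow _ _ => eapply ev_low; [env_tac|..]
    | echar PWord _ => eapply ev_charP; [env_tac|env_tac|env_tac|..]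
    | echar QWord _ => eapply ev_charQ; [env_tac|env_tac|env_tac|..]
    | eblk PWord _ _ => eapply ev_blockP; [env_tac|env_tac|env_tac|..]
    | eblk QWord _ _ => eapply ev_blockQ; [env_tac|env_tac|env_tac|..]
    | Var _ => eapply ev_var; env_tac
    | Cst _ => apply ev_cst
    | Op Add _ _ => eapply ev_add
    | Op Sub _ _ => eapply ev_sub
    | Op Mul _ _ => eapply ev_mul
    | Op Div _ _ => eapply ev_div
    | Op Mod _ _ => eapply ev_mod
    | Op And _ _ => eapply ev_and
    | Op Or _ _ => eapply ev_or
    | Op Xor _ _ => eapply ev_xor
    | Op Shl _ _ => eapply ev_shl
    | Op Shr _ _ => eapply ev_shr
    | Mem _ => eapply ev_mem
    end; ev_tac
  | _ => st
  end.

Ltac par_tac :=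
  repeat (apply par_set; [cbn; lia|]); assumption.

Ltac assign_tac := eapply wp_assign; [ev_tac|cbv beta].
Ltac store_tac := eapply wp_store; [ev_tac|ev_tac| |cbv beta].
Ltac out_tac := eapply wp_out; [ev_tac|cbv beta].

(** * Knuth-Morris-Pratt search and failure function *)

Definition fails (s : state) : Prop :=
  forall l, 1 <= l -> l <= m -> isfail P (smem s l) l.

Definition kinv (s : state) : Prop :=
  par L6 s /\ env s vi < m /\ env s vj <= n /\
  match_at P Q (env s vi) (env s vj) /\
  reported P Q (env s vj - env s vi) (sout s).

(** The potential is [2 (n - j) + i]: a round either advances [j], raising [i] by at most one, or
    lowers [i]. Stated for any intermediate state, the bound also serves for the characters left
    over by the block scan. *)
Lemma naive_spec s :
  kinv s -> fails s ->
  wps naive (fun T s' => Permutation (sout s') (occurrences P Q) /\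
    T <= 7 * (2 * (n - env s vj) + env s vi) + 1) s.
Proof.
  intros HI HF. pose proof w_pos.
  eapply wp_conseq.
  { apply (wp_while w _ _ A _ _ _ (fun s => env s vj) (fun _ => n)
      (fun s => 7 * (2 * (n - env s vj) + env s vi))
      (fun s => kinv s /\ fails s)); [auto| |].
    - intros s1 [(Hp & _) _]. split; ev_tac.
    - clear s HI HF. intros s [(Hp & Hi & Hj & HM & HR) HF] Hlt.
      remember (env s vi) as i eqn:Ei. remember (env s vj) as j eqn:Ej.
      symmetry in Ei, Ej. pose proof HM as [Hij _].
      eapply wp_if_eq; [ev_tac; lia|ev_tac; lia| |]; intros Ec.
      + apply wp_seq. assign_tac; [lia|lia|].
        apply wp_seq. assign_tac; [lia|lia|].
        eapply wp_if_eq; [ev_tac|ev_tac| |]; intros Em.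
        * apply wp_seq. out_tac. assign_tac; [lia|].
          assert (HM' : match_at P Q m (S j)).
          { rewrite <- Em, Nat.add_1_r. apply match_succ; auto. }
          pose proof (HF m ltac:(lia) ltac:(lia)) as Hf.
          pose proof Hf as (Hf1 & Hf2 & Hf3).
          rewrite Em.
          split; [|st; lia].
          split; [|exact HF].
          unfold kinv. split; [par_tac|].
          st.
          split; [lia|]. split; [lia|].
          rewrite Nat.add_1_r. split; [eapply match_border; eauto|].
          assert (HO : Occ P Q (j - i)).
          { destruct HM' as [_ HM']. split; [fold m n; lia|].
            intros k Hk. rewrite HM' by auto. f_equal; lia. }
          (* Of the starts skipped by the failure step only [j - i] itself is an occurrence, by
             [occ_skip]. *)
          apply (reported_app _ _ (j - i)); auto;
            [lia|repeat constructor; auto|].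
          intros k; split.
          -- intros [<-|[]]. exists (j - i).
             repeat split; try apply HO; fold m; lia.
          -- intros (u & Hu & Hu' & -> & Hu''). left. fold m.
             destruct (Nat.eq_dec u (j - i)); [lia|]. exfalso.
             eapply (occ_skip P Q m _ (S j) u); eauto; fold m; lia.
        * apply wp_skip.
          split; [|st; lia].
          split; [|exact HF].
          unfold kinv. split; [par_tac|].
          st.
          split; [lia|]. split; [lia|].
          rewrite !Nat.add_1_r. split; [apply match_succ; auto|].
          replace (S j - S i) with (j - i) by lia; auto.
      + eapply wp_if_eq; [ev_tac|ev_tac; lia| |]; intros E0.
        * assign_tac; [lia|lia|].
          split; [|st; lia].
          split; [|exact HF].
          unfold kinv. split; [par_tac|].
          st. subst i.
          rewrite E0 in *. rewrite Nat.sub_0_r in *.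
          split; [lia|]. split; [lia|]. split; [apply match_0|].
          eapply reported_extend; eauto; [lia|].
          intros u Hu Hu'. replace u with (j - 0) by lia.
          apply occ_mismatch; auto.
        * assign_tac; [lia|].
          pose proof (HF i ltac:(lia) ltac:(lia)) as Hf.
          pose proof Hf as (Hf1 & Hf2 & Hf3).
          split; [|st; lia].
          split; [|exact HF].
          unfold kinv. split; [par_tac|].
          st. rewrite Ej.
          split; [lia|]. split; [lia|].
          split; [eapply match_border; eauto|].
          eapply reported_extend; eauto; [lia|].
          intros u Hu Hu'. destruct (Nat.eq_dec u (j - i)) as [->|].
          -- apply occ_mismatch; auto.
          -- eapply occ_skip; eauto; fold m; lia. }
  intros T s' (((Hp & Hi & Hj & HM & HR) & _) & Hstop & HT).
  (* Since [j = n] and [i < m], any start from [j - i] on would overrun the text. *)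
  split; [|lia]. eapply reported_all; eauto. fold m n.
  pose proof HM as [Hij _]. lia.
Qed.

(** The clause on [S (env s vj)] records that all borders longer than [i] have failed to extend; it
    makes [i + 1] the failure value once the characters agree. *)
Definition finv (s : state) : Prop :=
  par L6 s /\ 1 <= env s vj /\ env s vj <= m /\ env s vi < env s vj /\
  border P (env s vi) (env s vj) /\
  (forall l, l <= env s vj -> border P l (S (env s vj)) -> l <= S (env s vi)) /\
  (forall l, 1 <= l -> l <= env s vj -> isfail P (smem s l) l).

Lemma failure_spec s :
  par L6 s ->
  wps failure (fun T s' => par L6 s' /\ fails s' /\ sout s' = sout s /\
    T <= 12 * m + 4) s.
Proof.
  intros Hp0. pose proof w_pos. pose proof w_lt. unfold failure.
  apply wp_seq. assign_tac; [lia|].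
  apply wp_seq. assign_tac; [lia|].
  apply wp_seq. store_tac; [lia|lia|lia|].
  eapply wp_conseq.
  { apply (wp_while w _ _ A _ _ _ (fun s => env s vj) (fun _ => m)
      (fun s => 6 * (2 * (m - env s vj) + env s vi))
      (fun s' => finv s' /\ sout s' = sout s)).
    - split; [|reflexivity]. unfold finv. split; [par_tac|]. st.
      split; [lia|]. split; [lia|]. split; [lia|]. split; [apply border_0|].
      split; [intros; lia|]. intros l H1 H2. replace l with 1 by lia.
      change (isfail P 0 1). split; [lia|].
      split; [apply border_0|]. intros; lia.
    - intros s1 [(Hp & _) _]. split; ev_tac.
    - intros s1 [(Hp & Hj & Hjm & Hij & HB & HS & HF) HO] Hlt.
      remember (env s1 vi) as i eqn:Ei. remember (env s1 vj) as j eqn:Ej.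
      symmetry in Ei, Ej.
      eapply wp_if_eq; [ev_tac; lia|ev_tac; lia| |]; intros Ec.
      + apply wp_seq. assign_tac; [lia|lia|].
        apply wp_seq. assign_tac; [lia|lia|].
        store_tac; [lia|].
        rewrite !Nat.add_1_r.
        split; [|st; lia]. split; [|exact HO].
        unfold finv. split; [par_tac|]. st.
        split; [lia|]. split; [lia|]. split; [lia|].
        split; [apply border_succ; auto|]. split.
        * intros [|l] Hl HBl; [lia|]. apply border_pred, HS in HBl; lia.
        * intros l H1 H2. unfold upd. destruct (Nat.eqb_spec l (S j)) as [->|].
          -- split; [lia|]. split; [apply border_succ; auto|].
             intros l Hl HBl. apply HS; auto; lia.
          -- apply HF; lia.
      + eapply wp_if_eq; [ev_tac|ev_tac; lia| |]; intros E0.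
        * apply wp_seq. assign_tac; [lia|lia|]. store_tac; [lia|lia|].
          rewrite !Nat.add_1_r.
          (* With [i = 0] the only length still possible is 1, and the mismatch [Ec] refutes it. *)
          assert (HZ : forall l, l <= j -> border P l (S j) -> l = 0).
          { intros [|l] Hl HBl; [auto|]. pose proof (HS _ Hl HBl).
            replace l with i in HBl by lia. apply border_last in HBl.
            destruct (Ec HBl). }
          split; [|st; lia]. split; [|exact HO].
          unfold finv. split; [par_tac|]. st. rewrite Ei, E0.
          split; [lia|]. split; [lia|]. split; [lia|].
          split; [apply border_0|]. split.
          -- intros [|l] Hl HBl; [lia|]. apply border_pred, HZ in HBl; lia.
          -- intros l H1 H2. unfold upd.
             destruct (Nat.eqb_spec l (S j)) as [->|]; [|apply HF; lia].
             split; [lia|]. split; [apply border_0|].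
             intros l Hl HBl. apply HZ in HBl; lia.
        * assign_tac; [lia|].
          pose proof (HF i ltac:(lia) ltac:(lia)) as (Hf1 & Hf2 & Hf3).
          split; [|st; lia]. split; [|exact HO].
          unfold finv. split; [par_tac|]. st. rewrite Ej.
          split; [lia|]. split; [lia|]. split; [lia|].
          split; [eapply border_trans; eauto|]. split; [|exact HF].
          intros [|l] Hl HBl; [lia|].
          (* Without its last character this border is shorter than [i], hence a border of [P[0,i)]
             and bounded by the failure value of [i]. *)
          pose proof (HS _ Hl HBl).
          assert (l <> i).
          { intros ->. apply border_last in HBl. auto. }
          apply border_pred in HBl.
          apply (border_shorter P l i) in HBl; [|lia|auto].
          apply Hf3 in HBl; lia. }
  st. intros T s' (((Hp & Hj & Hjm & Hij & HB & HS & HF) & HO) & Hstop & HT).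
  split; [auto|]. split; [|split; [auto|lia]].
  intros l H1 H2. apply HF; lia.
Qed.

(** * Block length and memory layout *)

Lemma ev_shift8 s e x :
  env s vb = b -> evs s e x -> evs s (shift8 e) (x / 2 ^ (8 * b)).
Proof.
  intros Eb He.
  replace (x / 2 ^ (8 * b)) with
    (Nat.shiftr (Nat.shiftr (Nat.shiftr (Nat.shiftr (Nat.shiftr (Nat.shiftr
      (Nat.shiftr (Nat.shiftr x b) b) b) b) b) b) b) b)
    by (rewrite !Nat.shiftr_shiftr, Nat.shiftr_div_pow2; do 2 f_equal; lia).
  repeat (apply ev_shr; [|constructor; auto]). auto.
Qed.

(** [u] is [log2 t / (8 b)] rounded down. It is kept apart from the minimum because the final bound
    on [log_sigma t] depends on which of the two terms limits [r]. The remaining quotient is a crude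
    potential, but [O(t)] is affordable. *)
Lemma choose_r_spec s :
  par L6 s ->
  wps choose_r (fun T s' => par L6 s' /\ smem s' = smem s /\ sout s' = sout s /\
    (exists u, 2 ^ (8 * u * b) <= t /\ t < 2 ^ (8 * S u * b) /\
       env s' vr = Nat.min u (q / 2)) /\
    T <= 3 * t + 5) s.
Proof.
  intros Hp0. pose proof w_pos. pose proof w_lt. unfold choose_r.
  assert (H2 : 2 < 2 ^ w).
  { apply Nat.lt_le_trans with (2 ^ 2); [cbn; lia|].
    apply Nat.pow_le_mono_r; lia. }
  assert (Hdiv : forall x, x / 2 ^ (8 * b) <= x).
  { intros x. apply Nat.Div0.div_le_upper_bound.
    pose proof (pow2_pos (8 * b)). nia. }
  apply wp_seq. assign_tac; [lia|].
  apply wp_seq. eapply wp_assign; [apply ev_shift8; [env_tac|ev_tac]|cbv beta].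
  apply wp_seq.
  eapply wp_conseq.
  { apply (wp_while w _ _ A _ _ _ (fun s => 0) (fun s => env s vu)
      (fun s => 3 * env s vu)
      (fun s' => par L6 s' /\ smem s' = smem s /\ sout s' = sout s /\
         2 ^ (8 * env s' vr * b) <= t /\
         env s' vu = t / 2 ^ (8 * S (env s' vr) * b))).
    - split; [par_tac|]. st. repeat split; auto.
      cbn; lia.
    - intros s1 (Hp & _). split; ev_tac; lia.
    - intros s1 (Hp & HM & HO & Hr & Hu) Hlt.
      remember (env s1 vr) as r eqn:Er. remember (env s1 vu) as u eqn:Eu.
      symmetry in Er, Eu.
      assert (Hr1 : 2 ^ (8 * S r * b) <= t).
      { destruct (Nat.le_gt_cases (2 ^ (8 * S r * b)) t) as [|Hgt]; auto.
        rewrite Nat.div_small in Hu by auto. lia. }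
      assert (Hrt : r < t).
      { apply Nat.lt_le_trans with (2 ^ r); [apply Nat.pow_gt_lin_r; lia|].
        etransitivity; [|exact Hr]. apply Nat.pow_le_mono_r; nia. }
      assert (Hdec : u / 2 ^ (8 * b) < u).
      { apply Nat.div_lt; [lia|]. apply Nat.pow_gt_1; lia. }
      apply wp_seq. assign_tac; [lia|lia|].
      eapply wp_assign; [apply ev_shift8; [env_tac|ev_tac]|cbv beta].
      st. split; [|lia]. split; [par_tac|]. split; [auto|]. split; [auto|].
      rewrite Nat.add_1_r. split; auto.
      rewrite Hu, Nat.Div0.div_div, <- Nat.pow_add_r. do 2 f_equal. lia. }
  intros T s1 ((Hp & HM & HO & Hr & Hu) & Hstop & HT).
  assert (Hrt : t < 2 ^ (8 * S (env s1 vr) * b)).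
  { apply Nat.div_small_iff; [apply Nat.pow_nonzero|]; lia. }
  remember (env s1 vr) as r eqn:Er. symmetry in Er.
  assert (HT' : T <= 3 * t + 1).
  { pose proof (Hdiv t). cbn [env set upd Nat.eqb] in HT. lia. }
  eapply wp_if_lt; [ev_tac; lia|ev_tac| |]; intros Hlt;
    rewrite Nat.shiftr_div_pow2, Nat.pow_1_r in Hlt.
  - assign_tac; [lia|]. rewrite Nat.shiftr_div_pow2, Nat.pow_1_r.
    split; [par_tac|]. st. split; [auto|]. split; [auto|]. split; [|lia].
    exists r. repeat split; auto. lia.
  - apply wp_skip. do 3 (split; [auto|]). split; [|lia].
    exists r. repeat split; auto. lia.
Qed.

Section Fast.

Variables (r N N3 : nat).

Hypothesis r_pos : 1 <= r.
Hypothesis rq : 2 * r <= q.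
Hypothesis rbw : 8 * (r * b) <= w.
Hypothesis HN : N = 2 ^ (r * b).
Hypothesis HN3 : N3 = N * N * N.
Hypothesis HA : 2 * m + 2 + 6 * N + N3 <= A.
Hypothesis Aw : A <= 2 ^ w.
Hypothesis m4 : 4 * m <= n.
Hypothesis N4 : N3 * N <= t.

(** The values of registers 0 to 18 during the block scan. The base addresses place the tables one
    after the other; their end is the left-hand side of [HA]. *)
Definition LF : list nat :=
  [m; n; b; q; w; t; r; r * b; N; r + 1; m + 1; 2 * m + 2;
   2 * m + 2 + 2 * N; 2 * m + 2 + 4 * N; 2 * m + 2 + 5 * N; 2 * m + 2 + 6 * N;
   Nat.shiftl (2 ^ (r + 1) - 1) (m + 1) mod 2 ^ w; 2 * N; N3].

Lemma r1N : 2 ^ r <= N.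
Proof. rewrite HN. apply Nat.pow_le_mono_r; nia. Qed.

Lemma rN : r + 1 <= N.
Proof.
  pose proof r1N. pose proof (Nat.pow_gt_lin_r 2 r ltac:(lia)). lia.
Qed.

Lemma N_le_N3 : N * N <= N3 /\ N <= N * N.
Proof.
  pose proof rN. rewrite HN3. split.
  - rewrite <- (Nat.mul_1_r (N * N)) at 1. apply Nat.mul_le_mono_l; lia.
  - rewrite <- (Nat.mul_1_r N) at 1. apply Nat.mul_le_mono_l; lia.
Qed.

Lemma r1w : r + 1 < w.
Proof. nia. Qed.

Lemma shiftl_1_mod x : x < w -> Nat.shiftl 1 x mod 2 ^ w = 2 ^ x.
Proof.
  intros Hx. rewrite Nat.shiftl_1_l. apply Nat.mod_small.
  apply Nat.pow_lt_mono_r; lia.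
Qed.

Lemma par_LF_L6 s : par LF s -> par L6 s.
Proof.
  intros H x Hx. rewrite H by (cbn in *; lia). cbn in Hx.
  do 6 (destruct x as [|x]; [reflexivity|]). lia.
Qed.

Lemma setup_spec s :
  par L6 s -> env s vr = r ->
  wps setup (fun T s' => par LF s' /\ smem s' = smem s /\ sout s' = sout s /\
    T <= 12) s.
Proof.
  intros Hp Er. pose proof w_pos. pose proof w_lt. pose proof rN.
  pose proof N_le_N3. pose proof r1w. unfold setup.
  assert (Hr2 : 2 ^ (r + 1) < 2 ^ w) by (apply Nat.pow_lt_mono_r; lia).
  pose proof (pow2_pos (r + 1)).
  do 11 (apply wp_seq; assign_tac;
    try solve [lia | st; rewrite ?shiftl_1_mod, <- ?HN by nia; lia]).
  assign_tac; try solve [rewrite shiftl_1_mod, <- HN by nia; lia].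
  split; [|repeat split; lia].
  rewrite !shiftl_1_mod, <- HN by nia.
  intros x Hx. cbn [length LF] in Hx.
  do 6 (destruct x as [|x]; [st; rewrite Hp by (cbn; lia); reflexivity|]).
  do 13 (destruct x as [|x]; [st; cbn [nth LF]; subst; try lia; reflexivity|]).
  lia.
Qed.

(** * Border masks, bit positions and block tables *)

Definition masks (s : state) : Prop :=
  forall i, i < m -> forall d, Nat.testbit (smem s (m + 1 + i)) d = true <->
    d <= r /\ d <= i /\ border P (i - d) i.

Lemma masks_loop_spec s :
  par LF s -> fails s ->
  wps masks_loop (fun T s' => par LF s' /\ masks s' /\ sout s' = sout s /\
    (forall a, a < m + 1 -> smem s' a = smem s a) /\ T <= 4 * m + 3) s.
Proof.
  intros Hp0 HF0. pose proof w_pos. pose proof w_lt. pose proof rN.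
  pose proof N_le_N3. pose proof r1w. unfold masks_loop.
  apply wp_seq. store_tac; [lia|lia|].
  apply wp_seq. assign_tac; [lia|].
  eapply wp_conseq.
  { apply (wp_while w _ _ A _ _ _ (fun s => env s vi) (fun _ => m)
      (fun s => 4 * (m - env s vi))
      (fun s' => par LF s' /\ sout s' = sout s /\
        (forall a, a < m + 1 -> smem s' a = smem s a) /\
        1 <= env s' vi /\ env s' vi <= m /\
        (forall i, i < env s' vi -> forall d,
           Nat.testbit (smem s' (m + 1 + i)) d = true <->
           d <= r /\ d <= i /\ border P (i - d) i))).
    - split; [par_tac|]. st. split; [auto|]. split.
      { intros a Ha. unfold upd.
        destruct (Nat.eqb_spec a (m + 1)); [lia|auto]. }
      split; [lia|]. split; [lia|]. intros i Hi d.
      replace i with 0 by lia. rewrite Nat.add_0_r. unfold upd.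
      rewrite Nat.eqb_refl. destruct d as [|d].
      + split; auto. intros _. repeat split; try lia.
      + change 1 with (2 ^ 0) at 1. rewrite Nat.pow2_bits_eqb. cbn.
        split; [discriminate|lia].
    - intros s1 (Hp & _). split; ev_tac.
    - intros s1 (Hp & HO & Hfr & Hi1 & Him & HK) Hlt.
      remember (env s1 vi) as i eqn:Ei. symmetry in Ei.
      pose proof (HF0 i ltac:(lia) ltac:(lia)) as Hf.
      rewrite <- Hfr in Hf by lia. remember (smem s1 i) as v eqn:Ev.
      symmetry in Ev. destruct Hf as (Hf1 & Hf2 & Hf3).
      apply wp_seq. assign_tac; [lia|].
      apply wp_seq. store_tac; rewrite ?Ev; try lia.
      assign_tac; [lia|lia|].
      split; [|st; lia]. split; [par_tac|]. st. split; [auto|].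
      split.
      { intros a Ha. unfold upd.
        destruct (Nat.eqb_spec a (m + 1 + i)); auto; lia. }
      split; [lia|]. split; [lia|]. intros k Hk d. unfold upd.
      destruct (Nat.eqb_spec (m + 1 + k) (m + 1 + i)) as [E|E];
        [|apply HK; lia].
      replace k with i in * by lia. clear E Hk k.
      rewrite Nat.lor_spec, Bool.orb_true_iff.
      change 1 with (2 ^ 0) at 1. rewrite Nat.pow2_bits_eqb.
      rewrite Nat.eqb_eq.
      destruct (Nat.eq_dec d 0) as [->|Hd].
      { split; auto. intros _. rewrite Nat.sub_0_r.
        repeat split; try lia. apply border_refl. }
      destruct (Nat.le_gt_cases d r) as [Hdr|Hdr].
      + rewrite !Nat.mod_pow2_bits_low by lia.
        destruct (Nat.le_gt_cases (i - v) d) as [Hvd|Hvd].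
        * rewrite Nat.shiftl_spec_high' by auto. rewrite HK by lia. split.
          -- intros [|(_ & Hd2 & Hd3)]; [lia|]. split; [lia|split; [lia|]].
             apply border_trans with v; auto.
             replace (i - d) with (v - (d - (i - v))) by lia. auto.
          -- intros (_ & Hd2 & Hd3). right. split; [lia|split; [lia|]].
             replace (v - (d - (i - v))) with (i - d) by lia.
             apply (border_shorter P _ _ i); auto; lia.
        (* A distance below [i - v] would belong to a proper border longer than the failure value
           [v]. *)
        * rewrite Nat.shiftl_spec_low by auto. split.
          -- intros [|]; [lia|discriminate].
          -- intros (_ & Hd2 & Hd3). apply Hf3 in Hd3; lia.
      + rewrite Nat.mod_pow2_bits_high by lia. split.
        * intros [|]; [lia|discriminate].
        * lia. }
  st. intros T s' ((Hp & HO & Hfr & Hi1 & Him & HK) & Hstop & HT).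
  split; [auto|]. split; [intros i Hi; apply HK; lia|].
  split; [auto|]. split; [auto|lia].
Qed.

Definition lowbit (y l : nat) : Prop :=
  Nat.testbit y l = true /\ forall k, k < l -> Nat.testbit y k = false.

(** The range suffices for all masks: they have [r + 1] bits, and [2^(r + 1) <= 2 N]. *)
Definition logs (s : state) : Prop :=
  forall y, 1 <= y -> y < 2 * N ->
    smem s (2 * m + 2 + 2 * N + y) = Nat.log2 y /\
    lowbit y (smem s (2 * m + 2 + y)).

Lemma lowbit_log2 y l : 1 <= y -> lowbit y l -> l <= Nat.log2 y.
Proof.
  intros Hy [H _]. apply Nat.nlt_ge. intros Hl.
  apply Nat.bits_above_log2 in Hl. congruence.
Qed.

Lemma logs_loop_spec s :
  par LF s ->
  wps logs_loop (fun T s' => par LF s' /\ logs s' /\ sout s' = sout s /\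
    (forall a, a < 2 * m + 2 -> smem s' a = smem s a) /\ T <= 10 * N + 4) s.
Proof.
  intros Hp0. pose proof w_pos. pose proof w_lt. pose proof rN.
  pose proof N_le_N3. pose proof r1w. unfold logs_loop.
  apply wp_seq. store_tac; try lia.
  apply wp_seq. store_tac; try lia.
  apply wp_seq. assign_tac; [lia|].
  eapply wp_conseq.
  { apply (wp_while w _ _ A _ _ _ (fun s => env s vy) (fun _ => 2 * N)
      (fun s => 5 * (2 * N - env s vy))
      (fun s' => par LF s' /\ sout s' = sout s /\
        (forall a, a < 2 * m + 2 -> smem s' a = smem s a) /\
        2 <= env s' vy /\ env s' vy <= 2 * N /\
        (forall y, 1 <= y -> y < env s' vy ->
          smem s' (2 * m + 2 + 2 * N + y) = Nat.log2 y /\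
          lowbit y (smem s' (2 * m + 2 + y))))).
    - split; [par_tac|]. st. split; [auto|]. split.
      { intros a Ha. unfold upd.
        destruct (Nat.eqb_spec a (2 * m + 2 + 2 * N + 1)); [lia|].
        destruct (Nat.eqb_spec a (2 * m + 2 + 1)); [lia|auto]. }
      split; [lia|]. split; [lia|]. intros y Hy1 Hy2.
      replace y with 1 by lia. unfold upd. rewrite !Nat.eqb_refl.
      destruct (Nat.eqb_spec (2 * m + 2 + 1) (2 * m + 2 + 2 * N + 1)); [lia|].
      split; auto. split; [reflexivity|intros; lia].
    - intros s1 (Hp & _). split; ev_tac.
    - intros s1 (Hp & HO & Hfr & Hy1 & Hy2 & HL) Hlt.
      remember (env s1 vy) as y eqn:Ey. symmetry in Ey.
      assert (Hh : 1 <= y / 2 /\ y / 2 < y).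
      { split; [|apply Nat.div_lt; lia].
        change 1 with (2 / 2). apply Nat.Div0.div_le_mono; lia. }
      destruct (HL (y / 2) ltac:(lia) ltac:(lia)) as [HL1 HL2].
      pose proof (lowbit_log2 _ _ (proj1 Hh) HL2) as HL3.
      pose proof (Nat.log2_lt_lin (y / 2) ltac:(lia)) as HL4.
      assert (Esh : Nat.shiftr y 1 = y / 2)
        by (rewrite Nat.shiftr_div_pow2, Nat.pow_1_r; auto).
      apply wp_seq. store_tac; rewrite ?Esh, ?HL1; try lia.
      remember (upd (smem s1) (2 * m + 2 + 2 * N + y) (Nat.log2 (y / 2) + 1))
        as M1 eqn:EM1.
      assert (Elog : Nat.log2 (y / 2) + 1 = Nat.log2 y).
      { rewrite <- Esh. rewrite Nat.log2_shiftr.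
        pose proof (Nat.log2_le_mono 2 y ltac:(lia)).
        change (Nat.log2 2) with 1 in *. lia. }
      assert (HM1 : forall a, a < 2 * m + 2 + 2 * N + y -> M1 a = smem s1 a).
      { intros a Ha. rewrite EM1. unfold upd.
        destruct (Nat.eqb_spec a (2 * m + 2 + 2 * N + y)); auto; lia. }
      set (s2 := store (2 * m + 2 + 2 * N + y) (Nat.log2 (y / 2) + 1) s1).
      assert (Es2 : smem s2 = M1) by (rewrite EM1; reflexivity).
      assert (Ey2 : env s2 vy = y) by exact Ey.
      assert (Hp2 : par LF s2) by exact Hp.
      assert (HO2 : sout s2 = sout s1) by reflexivity.
      clearbody s2.
      (* The common end of the even and the odd case, for an arbitrary lowest bit [l]. *)
      assert (Hend : forall l T, lowbit y l -> T <= 2 ->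
        wps (vy ::= Var vy +: Cst 1)
          (fun T2 s' =>
           (par LF s' /\ sout s' = sout s /\
            (forall a, a < 2 * m + 2 -> smem s' a = smem s a) /\
            2 <= env s' vy /\ env s' vy <= 2 * N /\
            (forall y, 1 <= y -> y < env s' vy ->
              smem s' (2 * m + 2 + 2 * N + y) = Nat.log2 y /\
              lowbit y (smem s' (2 * m + 2 + y)))) /\
           S (1 + (T + T2)) + 5 * (2 * N - env s' vy) <= 5 * (2 * N - y))
          (store (2 * m + 2 + y) l s2)).
      { intros l T Hl HT. assign_tac; [lia|lia|].
        split; [|st; lia]. split; [par_tac|]. st. rewrite Es2.
        split; [congruence|]. split.
        { intros a Ha. unfold upd.
          destruct (Nat.eqb_spec a (2 * m + 2 + y)); [lia|].
          rewrite HM1 by lia. auto. }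
        split; [lia|]. split; [lia|]. intros z Hz1 Hz2. unfold upd.
        destruct (Nat.eqb_spec (2 * m + 2 + 2 * N + z) (2 * m + 2 + y)); [lia|].
        destruct (Nat.eqb_spec (2 * m + 2 + z) (2 * m + 2 + y)) as [E|E].
        - replace z with y in * by lia. split; auto.
          rewrite EM1. unfold upd. rewrite Nat.eqb_refl; auto.
        - rewrite !HM1 by lia. apply HL; lia. }
      apply wp_seq.
      eapply wp_if_eq; [ev_tac; lia|ev_tac; lia| |]; intros Ev.
      + store_tac; rewrite ?Esh, ?Es2, ?HM1; try lia.
        apply Hend; [|lia].
        assert (Hsucc : forall k, Nat.testbit y (S k) = Nat.testbit (y / 2) k).
        { intros k. rewrite <- Esh, Nat.shiftr_spec', Nat.add_1_r; auto. }
        destruct HL2 as [HL5 HL6]. rewrite Nat.add_1_r. split.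
        * rewrite Hsucc; auto.
        * intros [|k] Hk.
          -- rewrite Nat.bit0_eqb, Ev; auto.
          -- rewrite Hsucc. apply HL6; lia.
      + store_tac; try lia. apply Hend; [|lia]. split; [|intros; lia].
        rewrite Nat.bit0_eqb. apply Nat.eqb_eq.
        pose proof (Nat.mod_upper_bound y 2 ltac:(lia)). lia. }
  st. intros T s' ((Hp & HO & Hfr & Hy1 & Hy2 & HL) & Hstop & HT).
  split; [auto|]. split; [intros y Ha Hb; apply HL; lia|].
  split; [auto|]. split; [auto|lia].
Qed.

Definition chk_ok (chk : cmd) (size : nat) (p : nat -> nat -> Prop) : Prop :=
  forall s B x,
  par LF s -> env s vB = B -> env s vx = x -> B < size -> x <= r ->
  wps chk (fun T s' => par LF s' /\ env s' vB = B /\ env s' vx = x /\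
    env s' vc = env s vc /\ smem s' = smem s /\ sout s' = sout s /\
    T <= 5 /\ (env s' vf = env s' vg <-> p B x)) s.

Definition bit_table (base size : nat) (p : nat -> nat -> Prop) (s : state) :=
  forall B, B < size -> forall x,
    Nat.testbit (smem s (base + B)) x = true <-> x <= r /\ p B x.

Lemma inner_spec chk size p s B :
  chk_ok chk size p -> par LF s -> env s vB = B -> B < size ->
  env s vc = 0 -> env s vx = 0 ->
  wps (While (CLt (Var vx) (Var vr1))
       (chk ;;
        If (CEq (Var vf) (Var vg))
          (vc ::= Op Or (Var vc) (Cst 1 <<: Var vx)) Skip ;;
        vx ::= Var vx +: Cst 1))
   (fun T s' => par LF s' /\ env s' vB = B /\ smem s' = smem s /\
      sout s' = sout s /\ T <= 9 * (r + 1) + 1 /\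
      forall x, Nat.testbit (env s' vc) x = true <-> x <= r /\ p B x) s.
Proof.
  intros Hchk Hp0 HB0 HB Hc0 Hx0. pose proof w_lt. pose proof r1w.
  eapply wp_conseq.
  { apply (wp_while w _ _ A _ _ _ (fun s => env s vx) (fun _ => r + 1)
      (fun s => 9 * (r + 1 - env s vx))
      (fun s' => par LF s' /\ env s' vB = B /\ smem s' = smem s /\
        sout s' = sout s /\ env s' vx <= r + 1 /\
        forall k, Nat.testbit (env s' vc) k = true <->
          k < env s' vx /\ k <= r /\ p B k)).
    - rewrite Hc0, Hx0. repeat split; auto; try lia.
      + rewrite Nat.bits_0 in *; discriminate.
      + rewrite Nat.bits_0 in *; discriminate.
      + rewrite Nat.bits_0 in *; discriminate.
    - intros s1 (Hp & _). split; ev_tac.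
    - intros s1 (Hp & HB1 & HM & HO & Hx & Hc) Hlt.
      remember (env s1 vx) as x eqn:Ex. symmetry in Ex.
      apply wp_seq.
      eapply wp_conseq; [apply (Hchk s1 B x); auto; lia|].
      intros T1 s2 (Hp2 & HB2 & Hx2 & Hc2 & HM2 & HO2 & HT & Heq). cbv beta.
      apply wp_seq. eapply wp_if_eq; [ev_tac|ev_tac| |]; intros E.
      + assign_tac; [lia|]. assign_tac; [lia|lia|].
        split; [|st; lia]. split; [par_tac|]. st.
        split; [auto|]. split; [congruence|]. split; [congruence|].
        split; [lia|]. intros k. rewrite shiftl_1_mod by lia.
        rewrite Nat.lor_spec, Bool.orb_true_iff, Nat.pow2_bits_eqb, Nat.eqb_eq.
        rewrite Hc. apply Heq in E. split.
        * intros [(Ha & Hb & Hcc)| <-]; repeat split; auto; lia.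
        * intros (Ha & Hb & Hcc). destruct (Nat.eq_dec x k); auto.
          left; repeat split; auto; lia.
      + apply wp_skip. assign_tac; [lia|lia|].
        split; [|st; lia]. split; [par_tac|]. st.
        split; [auto|]. split; [congruence|]. split; [congruence|].
        split; [lia|]. intros k. rewrite Hc2, Hc. split.
        * intros (Ha & Hb & Hcc); repeat split; auto; lia.
        * intros (Ha & Hb & Hcc). repeat split; auto.
          destruct (Nat.eq_dec x k) as [->|]; [|lia].
          exfalso. apply E, Heq; auto. }
  intros T s' ((Hp & HB1 & HM & HO & Hx & Hc) & Hstop & HT).
  rewrite Hx0 in HT. split; [auto|]. split; [auto|]. split; [auto|].
  split; [auto|]. split; [lia|]. intros x. rewrite Hc. split; [tauto|].
  intros [Ha Hb]; repeat split; auto; lia.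
Qed.

Lemma table_spec base size chk p s :
  base < 19 -> size < 19 -> 0 < nth base LF 0 ->
  nth base LF 0 + nth size LF 0 <= A ->
  chk_ok chk (nth size LF 0) p -> par LF s ->
  wps (table base size chk) (fun T s' => par LF s' /\ sout s' = sout s /\
    (forall a, a < nth base LF 0 -> smem s' a = smem s a) /\
    bit_table (nth base LF 0) (nth size LF 0) p s' /\
    T <= nth size LF 0 * (9 * (r + 1) + 6) + 2) s.
Proof.
  intros Hbase Hsize Hpos HAd Hchk Hp0. pose proof w_lt. pose proof w_pos.
  unfold table.
  remember (nth base LF 0) as bv eqn:Eb. remember (nth size LF 0) as sv eqn:Es.
  assert (Hbv : forall s, par LF s -> env s base = bv)
    by (intros s1 H1; rewrite H1; auto; cbn; lia).
  assert (Hsv : forall s, par LF s -> env s size = sv)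
    by (intros s1 H1; rewrite H1; auto; cbn; lia).
  apply wp_seq. assign_tac; [lia|].
  eapply wp_conseq.
  { apply (wp_while w _ _ A _ _ _ (fun s => env s vB) (fun _ => sv)
      (fun s => (sv - env s vB) * (9 * (r + 1) + 6))
      (fun s' => par LF s' /\ sout s' = sout s /\
        (forall a, a < bv -> smem s' a = smem s a) /\ env s' vB <= sv /\
        bit_table bv (env s' vB) p s')).
    - split; [par_tac|]. st. repeat split; auto; lia.
    - intros s1 (Hp & _). split; [ev_tac|]. constructor; auto.
    - intros s1 (Hp & HO & Hfr & HB & HT) Hlt.
      remember (env s1 vB) as B eqn:EB. symmetry in EB.
      apply wp_seq. assign_tac; [lia|]. apply wp_seq. assign_tac; [lia|].
      apply wp_seq. eapply wp_conseq.
      { apply (inner_spec chk sv p _ B); auto. par_tac. }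
      st. intros T1 s2 (Hp2 & HB2 & HM2 & HO2 & HT2 & Hc2). cbv beta.
      apply wp_seq.
      eapply wp_store.
      { eapply ev_add; [constructor; apply Hbv; auto|ev_tac|lia]. }
      { ev_tac. }
      { lia. }
      assign_tac; [lia|lia|].
      split; [|st; replace (sv - B) with (S (sv - (B + 1))) by lia;
                rewrite Nat.mul_succ_l; lia].
      split; [par_tac|]. st. split; [congruence|]. split.
      { intros a Ha. unfold upd. destruct (Nat.eqb_spec a (bv + B)); [lia|].
        rewrite HM2; auto. }
      split; [lia|]. intros k Hk x. st. unfold upd.
      destruct (Nat.eqb_spec (bv + k) (bv + B)) as [E|E].
      + replace k with B by lia. apply Hc2.
      + rewrite HM2. apply HT; lia. }
  st. intros T s' ((Hp & HO & Hfr & HB & HT) & Hstop & HT').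
  split; [auto|]. split; [auto|]. split; [auto|].
  split; [|lia]. intros B HB'. apply HT; lia.
Qed.

(* The block [B] ends with the prefix [P[0,x)]. *)
Definition pG (B x : nat) : Prop :=
  x < m /\ B / 2 ^ ((r - x) * b) = code b pf 0 x.

(* After [x] characters of the block [B] the text ends with the last
   [min x m] characters of [P], so an occurrence of [P] may end there. *)
Definition pE (B x : nat) : Prop :=
  B mod 2 ^ (x * b) / 2 ^ ((x - Nat.min x m) * b)
  = code b pf (m - Nat.min x m) (Nat.min x m).

(* [B] codes a window of [2 r] characters and a block, which occurs in the
   window at the offset [r - x]. *)
Definition pX (B x : nat) : Prop :=
  (B / N / 2 ^ ((r - x) * b)) mod N = B mod N.

Lemma chkG_ok : chk_ok chkG N pG.
Proof.
  intros s B x Hp EB Ex HB Hx. pose proof w_lt. pose proof r1w.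
  pose proof w_pos.
  assert (Hxb : (r - x) * b <= w) by nia. assert (Hxb' : x * b <= w) by nia.
  unfold chkG. apply wp_seq. assign_tac; try lia.
  rewrite Nat.shiftr_div_pow2.
  eapply wp_if_lt; [ev_tac|ev_tac| |]; intros Hlt.
  - assign_tac; try lia.
    split; [par_tac|]. st. do 5 (split; [auto|]). split; [lia|].
    unfold pG; tauto.
  - assign_tac.
    split; [par_tac|]. st. do 5 (split; [auto|]). split; [lia|]. split.
    + intros E. exfalso. assert (B / 2 ^ ((r - x) * b) <= B); [|lia].
      apply Nat.Div0.div_le_upper_bound. rewrite <- (Nat.mul_1_l B) at 1.
      apply Nat.mul_le_mono_r, pow2_pos.
    + intros [Ha _]; lia.
Qed.

Lemma chkE_ok : chk_ok chkE N pE.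
Proof.
  intros s B x Hp EB Ex HB Hx. pose proof w_lt. pose proof r1w.
  pose proof w_pos.
  assert (Hxb' : x * b <= w) by nia.
  assert (Htail : forall s1 T0, T0 <= 3 -> par LF s1 -> env s1 vB = B ->
    env s1 vx = x -> env s1 vc = env s vc -> smem s1 = smem s ->
    sout s1 = sout s -> env s1 vz = Nat.min x m ->
    wps (vf ::= elow (Var vB) (Var vx *: Var vb)
                >>: ((Var vx -: Var vz) *: Var vb) ;;
         vg ::= eblk PWord (Var vm -: Var vz) (Var vz *: Var vb))
      (fun T s' => par LF s' /\ env s' vB = B /\ env s' vx = x /\
        env s' vc = env s vc /\ smem s' = smem s /\ sout s' = sout s /\
        T0 + T <= 5 /\ (env s' vf = env s' vg <-> pE B x)) s1).
  { intros s1 T0 HT0 Hp1 EB1 Ex1 Ec1 EM1 EO1 Ez1.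
    assert (Hz : (x - Nat.min x m) * b <= w) by nia.
    assert (Hz' : Nat.min x m * b <= w) by nia.
    apply wp_seq. assign_tac; try lia. assign_tac; try lia.
    split; [par_tac|]. st. rewrite Nat.shiftr_div_pow2.
    repeat split; auto; lia. }
  unfold chkE. apply wp_seq. assign_tac.
  apply wp_seq. eapply wp_if_lt; [ev_tac|ev_tac| |]; intros Hlt.
  - assign_tac. eapply wp_conseq; [apply (Htail _ 3); auto; [par_tac|st; lia]|].
    intros T s' (K1 & K2 & K3 & K4 & K5 & K6 & K7 & K8).
    do 6 (split; [assumption|]). split; [lia|assumption].
  - apply wp_skip.
    eapply wp_conseq; [apply (Htail _ 3); auto; [par_tac|st; lia]|].
    intros T s' (K1 & K2 & K3 & K4 & K5 & K6 & K7 & K8).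
    do 6 (split; [assumption|]). split; [lia|assumption].
Qed.

Lemma chkX_ok : chk_ok chkX N3 pX.
Proof.
  intros s B x Hp EB Ex HB Hx. pose proof w_lt. pose proof r1w.
  pose proof w_pos.
  assert (Hxb : (r - x) * b <= w) by nia.
  unfold chkX. apply wp_seq. assign_tac; try lia. assign_tac; try lia.
  split; [par_tac|]. st. rewrite !Nat.shiftr_div_pow2, <- HN.
  repeat split; auto; lia.
Qed.

(** * Table entries as statements about the text *)

Lemma pE_iff j x : x <= r ->
  pE (code b qf j r) x <->
  forall k, k < Nat.min x m ->
    qf (j + (x - Nat.min x m) + k) = pf (m - Nat.min x m + k).
Proof.
  intros Hx. unfold pE. rewrite code_mod, code_div by (auto; lia).
  replace (x - (x - Nat.min x m)) with (Nat.min x m) by lia.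
  apply code_eq_iff; auto.
Qed.

Lemma pG_iff j x : x <= r ->
  pG (code b qf j r) x <->
  x < m /\ forall k, k < x -> qf (j + (r - x) + k) = pf k.
Proof.
  intros Hx. unfold pG. rewrite code_div by (auto; lia).
  replace (r - (r - x)) with x by lia.
  rewrite (code_eq_iff b qf pf) by auto. reflexivity.
Qed.

(** Division by [N] and reduction modulo [N] separate the window from the block; a shifted and
    truncated window is again a code of [r] characters. *)
Lemma pX_iff a j x : x <= r ->
  pX (code b pf a (2 * r) * N + code b qf j r) x <->
  forall k, k < r -> pf (a + (r - x) + k) = qf (j + k).
Proof.
  intros Hx. pose proof rN. unfold pX.
  assert (HB : code b qf j r < N) by (rewrite HN; apply code_lt; auto).
  rewrite Nat.div_add_l, (Nat.div_small (code b qf j r)), Nat.add_0_r by lia.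
  rewrite (Nat.add_comm (_ * N)), Nat.Div0.mod_add,
    (Nat.mod_small (code b qf j r)) by auto.
  rewrite code_div by (auto; lia). rewrite HN, code_mod by (auto; lia).
  apply code_eq_iff; auto.
Qed.

Lemma testbit_shiftl_mod x k i :
  i < w -> Nat.testbit (Nat.shiftl x k mod 2 ^ w) i =
           ((k <=? i) && Nat.testbit x (i - k))%bool.
Proof.
  intros Hi. rewrite Nat.mod_pow2_bits_low by auto.
  destruct (Nat.leb_spec k i).
  - rewrite Nat.shiftl_spec_high'; auto.
  - rewrite Nat.shiftl_spec_low; auto.
Qed.

(** For [x <= m] the border supplies the first [m - x] characters of the occurrence, already read,
    and [pE] the last [x]. For [x > m] the predicate [pE] alone checks all of [P]. *)
Lemma report_bits EB Ki i j :
  i < m -> match_at P Q i j -> j + r <= n ->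
  (forall x, Nat.testbit EB x = true <-> x <= r /\ pE (code b qf j r) x) ->
  (forall d, Nat.testbit Ki d = true <->
     d <= r /\ d <= i /\ border P (i - d) i) ->
  forall x,
  Nat.testbit (Nat.land EB (Nat.lor (Nat.shiftl Ki (m - i) mod 2 ^ w)
    (Nat.shiftl (2 ^ (r + 1) - 1) (m + 1) mod 2 ^ w))) x = true <->
  x <= r /\ m - i <= x /\ Occ P Q (j + x - m).
Proof.
  intros Hi HM Hj HE HK x. pose proof r1w. pose proof HM as [Hij HMk].
  rewrite Nat.land_spec, Nat.lor_spec, Bool.andb_true_iff, HE.
  destruct (Nat.le_gt_cases x r) as [Hx|Hx]; [|split; lia].
  rewrite pE_iff, Bool.orb_true_iff, !testbit_shiftl_mod by lia.
  rewrite !Bool.andb_true_iff, HK, !Nat.leb_le.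
  destruct (Nat.le_gt_cases x m) as [Hxm|Hxm].
  - rewrite Nat.min_l by auto. rewrite Nat.sub_diag, Nat.add_0_r. split.
    + intros [[_ Hq] [(H1 & H2 & H3 & H4)|[H1 _]]]; [|lia].
      split; auto. split; auto. split; [fold m n; lia|]. fold m. intros k Hk.
      change (pf k = qf (j + x - m + k)).
      destruct (Nat.lt_ge_cases k (m - x)) as [Hk'|Hk'].
      * destruct H4 as [_ H4].
        transitivity (pf (i - (i - (x - (m - i))) + k)); [apply H4; lia|].
        etransitivity; [apply HMk; lia|]. unfold qf; f_equal; lia.
      * replace k with (m - x + (k - (m - x))) by lia.
        rewrite <- Hq by lia. f_equal; lia.
    + intros (_ & H1 & HO). pose proof HO as [HO1 HO2]. fold m n in HO1, HO2.
      split; [split; auto|].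
      * intros k Hk. symmetry. etransitivity; [apply HO2; lia|].
        unfold qf; f_equal; lia.
      * left. split; auto. split; [lia|]. split; [lia|].
        pose proof (occ_border P Q i j (j + x - m) HM) as HB. fold m in HB.
        replace (i - (x - (m - i))) with (j - (j + x - m)) by lia.
        apply HB; auto; lia.
  - rewrite Nat.min_r by lia. rewrite Nat.sub_diag. split.
    + intros [[_ Hq] _]. split; auto. split; [lia|]. split; [fold m n; lia|].
      fold m. intros k Hk. change (pf k = qf (j + x - m + k)).
      etransitivity; [symmetry; apply Hq; lia|]. f_equal; lia.
    + intros (_ & H1 & HO1 & HO2). fold m n in HO1, HO2. split; [split; auto|].
      * intros k Hk. symmetry. etransitivity; [apply HO2; lia|].
        unfold qf; f_equal; lia.
      * right. split; [lia|].
        replace (2 ^ (r + 1) - 1) with (Nat.ones (r + 1))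
          by (rewrite Nat.ones_equiv; lia).
        apply Nat.ones_spec_low; lia.
Qed.

(** * One round of the block scan *)

Definition survivor (i j d : nat) : Prop :=
  d <= r /\ d <= i /\ border P (i - d) i /\ i - d + r < m /\
  forall k, k < r -> pf (i - d + k) = qf (j + k).

Lemma occ_survivor i j u :
  i < m -> match_at P Q i j -> Occ P Q u -> j - i <= u -> u <= j ->
  u - (j - i) <= r -> j + r < u + m -> survivor i j (u - (j - i)).
Proof.
  intros Hi HM HO H1 H2 H3 H4. pose proof HM as [Hij _].
  split; auto. split; [lia|]. split.
  - replace (i - (u - (j - i))) with (j - u) by lia.
    apply (occ_border P Q); auto. fold m; lia.
  - split; [lia|]. intros k Hk. destruct HO as [_ HO]. fold m in HO.
    etransitivity; [apply HO; lia|]. unfold qf; f_equal; lia.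
Qed.

Definition bits (e : nat) : list nat := filter (Nat.testbit e) (seq 0 (r + 1)).

Lemma in_bits e x : In x (bits e) <-> x <= r /\ Nat.testbit e x = true.
Proof.
  unfold bits. rewrite filter_In, in_seq. split; intros []; split; auto; lia.
Qed.

(** By the last two hypotheses, an occurrence starting from [j - i] on starts before [d] exactly if
    it ends within the block. So the reports of one block are precisely those missing up to [d]. *)
Lemma reported_step e i j d o :
  i < m -> i <= j ->
  (forall x, Nat.testbit e x = true <->
     x <= r /\ m - i <= x /\ Occ P Q (j + x - m)) ->
  reported P Q (j - i) o -> j - i <= d ->
  (forall u, Occ P Q u -> j - i <= u -> u < d -> u + m <= j + r) ->
  (forall u, Occ P Q u -> j - i <= u -> u + m <= j + r -> u < d) ->
  reported P Q d (o ++ map (fun x => j + x) (bits e)).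
Proof.
  intros Hi Hij He HR Hd H1 H2. eapply reported_app; eauto.
  - apply FinFun.Injective_map_NoDup.
    + intros x y; lia.
    + apply NoDup_filter, seq_NoDup.
  - intros k. fold m. rewrite in_map_iff. split.
    + intros (x & <- & Hx). apply in_bits in Hx as [Hx Hb].
      apply He in Hb as (_ & Hb & HO). exists (j + x - m).
      repeat split; try apply HO; try lia. apply H2; auto; lia.
    + intros (u & Hu & Hu' & -> & HO). exists (u + m - j). split; [lia|].
      specialize (H1 u HO Hu Hu'). apply in_bits. split; [lia|]. apply He.
      split; [lia|]. split; [lia|]. replace (j + (u + m - j) - m) with u by lia.
      auto.
Qed.

(** One iteration of the report loop: the exclusive or removes the lowest bit. *)
Lemma bits_lowbit e l :
  l <= r -> lowbit e l -> bits e = l :: bits (Nat.lxor e (2 ^ l)).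
Proof.
  intros Hl [H1 H2]. unfold bits.
  replace (r + 1) with (l + S (r - l)) by lia.
  rewrite seq_app, !filter_app. cbn [seq].
  assert (E : forall f, (forall k, k < l -> f k = false) ->
    filter f (seq 0 l) = []).
  { intros f Hf. rewrite (filter_ext_in f (fun _ => false)).
    - induction (seq 0 l); auto.
    - intros k Hk. apply in_seq in Hk. apply Hf; lia. }
  rewrite !E; cbn [app].
  - cbn [filter]. rewrite Nat.add_0_l, H1. rewrite Nat.lxor_spec, H1.
    rewrite Nat.pow2_bits_eqb, Nat.eqb_refl. cbn. f_equal.
    apply filter_ext_in. intros k Hk. apply in_seq in Hk.
    rewrite Nat.lxor_spec, Nat.pow2_bits_eqb.
    destruct (Nat.eqb_spec l k); [lia|]. destruct (Nat.testbit e k); auto.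
  - intros k Hk. rewrite Nat.lxor_spec, Nat.pow2_bits_eqb, H2 by auto.
    destruct (Nat.eqb_spec l k); [lia|]. auto.
  - auto.
Qed.

Lemma bits_0 : bits 0 = [].
Proof.
  unfold bits. induction (seq 0 (r + 1)) as [|x l IH]; auto.
  cbn [filter]. rewrite Nat.bits_0. auto.
Qed.

Lemma bits_lt e :
  (forall x, Nat.testbit e x = true -> x <= r) -> e < 2 * N.
Proof.
  intros H. apply Nat.lt_le_trans with (2 ^ (r + 1)).
  - apply lt_pow2_testbit. intros i Hi.
    destruct (Nat.testbit e i) eqn:E; auto. apply H in E. lia.
  - rewrite Nat.pow_add_r. pose proof r1N. cbn; lia.
Qed.

Lemma report_loop_spec s j e :
  par LF s -> logs s -> env s vj = j -> env s ve = e -> j + r <= n ->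
  (forall x, Nat.testbit e x = true -> x <= r) ->
  wps report_loop (fun T s' => par LF s' /\ smem s' = smem s /\
    sout s' = sout s ++ map (fun x => j + x) (bits e) /\
    env s' vi = env s vi /\ env s' vj = j /\ env s' vB = env s vB /\
    T <= 4 * length (bits e) + 1) s.
Proof.
  intros Hp0 HL Ej Ee Hj He. pose proof w_lt. pose proof r1w.
  pose proof N_le_N3. pose proof rN. unfold report_loop.
  eapply wp_conseq.
  { apply (wp_while w _ _ A _ _ _ (fun s => 0) (fun s => env s ve)
      (fun s => 4 * length (bits (env s ve)))
      (fun s' => par LF s' /\ smem s' = smem s /\
        sout s' ++ map (fun x => j + x) (bits (env s' ve))
        = sout s ++ map (fun x => j + x) (bits e) /\
        env s' vi = env s vi /\ env s' vj = j /\ env s' vB = env s vB /\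
        (forall x, Nat.testbit (env s' ve) x = true -> x <= r))).
    - rewrite Ee. repeat split; auto.
    - intros s1 (Hp & _). split; ev_tac; lia.
    - intros s1 (Hp & HM & HO & Hi1 & Hj1 & HB1 & He1) Hlt.
      remember (env s1 ve) as f eqn:Ef. symmetry in Ef.
      pose proof (bits_lt f He1) as Hf.
      destruct (HL f ltac:(lia) Hf) as [_ HL2]. rewrite <- HM in HL2.
      pose proof (He1 _ (proj1 HL2)) as Hl.
      pose proof (bits_lowbit f _ Hl HL2) as Eb.
      remember (smem s1 (2 * m + 2 + f)) as l eqn:El. symmetry in El.
      apply wp_seq. assign_tac; try lia.
      apply wp_seq. out_tac; try lia.
      assign_tac; [lia|]. rewrite El, shiftl_1_mod by lia.
      rewrite Eb in *. cbn [map length] in *.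
      split; [|st; lia].
      split; [par_tac|]. st. split; [auto|].
      split; [rewrite <- app_assoc; auto|].
      repeat split; auto.
      intros x Hx. rewrite Nat.lxor_spec, Nat.pow2_bits_eqb in Hx.
      destruct (Nat.eqb_spec l x); [lia|]. apply He1.
      destruct (Nat.testbit f x); auto. }
  intros T s' ((Hp & HM & HO & Hi1 & Hj1 & HB1 & He1) & Hstop & HT).
  replace (env s' ve) with 0 in * by lia. rewrite bits_0 in HO.
  cbn [map] in HO. rewrite app_nil_r in HO. rewrite Ee in HT.
  repeat split; auto; lia.
Qed.

(** In both cases [a + (r - (d + u)) = i - d], so bit [d + u] of the table entry speaks about the
    candidate at distance [d]. *)
Lemma survivor_bits XV Ki i j a u :
  (a = i - r /\ u = 0 /\ r < i) \/ (a = 0 /\ u = r - i /\ i <= r) ->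
  (forall x, Nat.testbit XV x = true <->
     x <= r /\ pX (code b pf a (2 * r) * N + code b qf j r) x) ->
  (forall d, Nat.testbit Ki d = true <->
     d <= r /\ d <= i /\ border P (i - d) i) ->
  forall d, Nat.testbit (Nat.land (Nat.shiftr XV u) Ki) d = true <->
    d <= r /\ d <= i /\ border P (i - d) i /\
    forall k, k < r -> pf (i - d + k) = qf (j + k).
Proof.
  intros Hau HX HK d.
  rewrite Nat.land_spec, Nat.shiftr_spec', Bool.andb_true_iff, HX, HK.
  assert (E : d <= r -> d <= i -> d + u <= r /\ a + (r - (d + u)) = i - d)
    by lia.
  split.
  - intros [[H1 H2] (H3 & H4 & H5)]. destruct (E H3 H4) as [E1 E2].
    rewrite pX_iff, E2 in H2 by auto. auto.
  - intros (H3 & H4 & H5 & H6). destruct (E H3 H4) as [E1 E2].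
    rewrite pX_iff, E2 by auto. auto.
Qed.

Lemma cut_bits y k d :
  (forall x, Nat.testbit y x = true -> x <= r) ->
  Nat.testbit (Nat.shiftl (Nat.shiftr y k) k mod 2 ^ w) d = true <->
  k <= d /\ Nat.testbit y d = true.
Proof.
  intros Hy. pose proof r1w. destruct (Nat.lt_ge_cases d w) as [Hd|Hd].
  - rewrite testbit_shiftl_mod, Nat.shiftr_spec', Bool.andb_true_iff by auto.
    rewrite Nat.leb_le. split; intros [H1 H2]; split; auto.
    + replace d with (d - k + k) by lia; auto.
    + replace (d - k + k) with d by lia; auto.
  - rewrite Nat.mod_pow2_bits_high by auto. split; [discriminate|].
    intros [_ H2]. apply Hy in H2. lia.
Qed.

Definition tables (s : state) : Prop :=
  fails s /\ masks s /\ logs s /\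
  bit_table (2 * m + 2 + 4 * N) N pG s /\
  bit_table (2 * m + 2 + 5 * N) N pE s /\
  bit_table (2 * m + 2 + 6 * N) N3 pX s.

Definition binv (s : state) : Prop :=
  par LF s /\ tables s /\ env s vi < m /\ env s vj <= n /\
  match_at P Q (env s vi) (env s vj) /\
  reported P Q (env s vj - env s vi) (sout s).

Lemma log2_top x k : Nat.testbit x k = true -> k <= Nat.log2 x.
Proof.
  intros H. apply Nat.nlt_ge. intros Hl. apply Nat.bits_above_log2 in Hl.
  congruence.
Qed.

Lemma testbit_pos x k : Nat.testbit x k = true -> 1 <= x.
Proof. destruct x; [rewrite Nat.bits_0; discriminate|lia]. Qed.

(** The gain in [2 j - i] is [r + d] for a survivor [d], at least [r + i] when [j] advances without
    one, and [i - v > r] for a failure step to [v]. *)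
Lemma transition_spec s i j y o e :
  par LF s -> tables s -> env s vi = i -> env s vj = j -> env s vy = y ->
  env s vB = code b qf j r -> i < m -> j + r <= n -> match_at P Q i j ->
  (forall d, Nat.testbit y d = true <-> survivor i j d) ->
  (forall x, Nat.testbit e x = true <->
     x <= r /\ m - i <= x /\ Occ P Q (j + x - m)) ->
  reported P Q (j - i) o ->
  sout s = o ++ map (fun x => j + x) (bits e) ->
  wps transition (fun T s' => binv s' /\ T <= 4 /\ sout s' = sout s /\
    2 * j - i + r <= 2 * env s' vj - env s' vi) s.
Proof.
  intros Hp HT Ei Ej Ey EB Hi Hj HM Hy He HR HO.
  pose proof w_lt. pose proof w_pos. pose proof r1w. pose proof rN.
  pose proof N_le_N3. pose proof HM as [Hij _].
  pose proof HT as (TF & TK & TL & TG & TE & TX).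
  pose proof (reported_step e i j) as HS.
  remember (code b qf j r) as B eqn:EBc.
  assert (HB : B < N) by (rewrite EBc, HN; apply code_lt; auto).
  assert (HK := TK i Hi).
  remember (smem s (m + 1 + i)) as Ki eqn:EKi. symmetry in EKi.
  assert (HKlt : Ki < 2 * N)
    by (apply bits_lt; intros x Hx; apply HK in Hx; lia).
  unfold transition.
  eapply wp_if_eq; [ev_tac|ev_tac; lia| |]; intros E0.
  - assert (Hno : forall d, ~ survivor i j d).
    { intros d Hd. apply Hy in Hd. rewrite E0, Nat.bits_0 in Hd. discriminate. }
    eapply wp_if_lt; [ev_tac|ev_tac| |]; intros Hri.
    + assert (HK0 : Nat.testbit Ki 0 = true).
      { apply HK. split; [lia|]. split; [lia|]. rewrite Nat.sub_0_r.
        apply border_refl. }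
      pose proof (testbit_pos _ _ HK0) as HKp.
      destruct (TL Ki HKp HKlt) as [EH _].
      assert (HD := Nat.bit_log2 Ki ltac:(lia)). apply HK in HD.
      destruct HD as (HD1 & HD2 & HD3).
      remember (Nat.log2 Ki) as D eqn:ED.
      pose proof (TF (i - D) ltac:(lia) ltac:(lia)) as Hf.
      pose proof Hf as (Hf1 & Hf2 & Hf3).
      assign_tac; rewrite ?EKi, ?EH; try lia.
      remember (smem s (i - D)) as v eqn:Ev. symmetry in Ev.
      (* If [v >= i - r], then [i - v] would be a bit of the mask above its highest bit [D]. *)
      assert (Hv : v < i - r).
      { apply Nat.nle_gt. intros Hge.
        assert (Hb : Nat.testbit Ki (i - v) = true).
        { apply HK. split; [lia|]. split; [lia|].
          replace (i - (i - v)) with v by lia.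
          eapply border_trans; eauto. }
        apply log2_top in Hb. lia. }
      split; [|st; split; [lia|split; [auto|lia]]].
      split; [par_tac|]. split; [exact HT|]. st. rewrite Ej.
      split; [lia|]. split; [lia|]. split.
      { eapply match_border; [exact HM|]. eapply border_trans; eauto. }
      rewrite HO. apply HS; auto; [lia| |].
      * intros u HOu Hu1 Hu2. apply Nat.nlt_ge. intros Hlt.
        pose proof (occ_border P Q i j u HM ltac:(fold m; lia) HOu Hu1
          ltac:(lia)) as Hbu.
        (* An occurrence not ending in the block would survive if its distance is at most [r]; at a
           larger distance it yields a border of [P[0,i-D)] longer than its failure value. *)
        destruct (Nat.le_gt_cases (u - (j - i)) r) as [Hur|Hur].
        -- apply (Hno (u - (j - i))). apply occ_survivor; auto; lia.
        -- assert (Hbu' : border P (j - u) (i - D)).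
           { apply (border_shorter P _ _ i); auto; lia. }
           apply Hf3 in Hbu'; lia.
      * intros u HOu Hu1 Hu2. lia.
    + assert (HGB := TG B HB).
      remember (smem s (2 * m + 2 + 4 * N + B)) as GB eqn:EGB.
      symmetry in EGB.
      (* The empty prefix always fits, so the entry has a highest bit. *)
      assert (HGp : 1 <= GB).
      { apply (testbit_pos _ 0). apply HGB. split; [lia|]. rewrite EBc.
        apply pG_iff; [lia|]. split; [lia|]. intros; lia. }
      assert (HGlt : GB < 2 * N)
        by (apply bits_lt; intros x Hx; apply HGB in Hx; lia).
      destruct (TL GB HGp HGlt) as [EH _].
      assert (Hg := Nat.bit_log2 GB ltac:(lia)). apply HGB in Hg.
      remember (Nat.log2 GB) as g eqn:Eg.
      destruct Hg as [Hg1 Hg2]. rewrite EBc in Hg2.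
      apply pG_iff in Hg2; [|lia]. destruct Hg2 as [Hg2 Hg3].
      apply wp_seq. assign_tac; rewrite ?EGB, ?EH; try lia.
      assign_tac; try lia.
      split; [|st; split; [lia|split; [auto|lia]]].
      split; [par_tac|]. split; [exact HT|]. st.
      split; [lia|]. split; [lia|]. split.
      { split; [lia|]. intros k Hk. symmetry.
        etransitivity; [|apply Hg3; auto]. unfold qf; f_equal; lia. }
      rewrite HO. apply HS; auto; [lia| |].
      * intros u HOu Hu1 Hu2. apply Nat.nlt_ge. intros Hlt.
        destruct (Nat.le_gt_cases u j) as [Huj|Huj].
        -- apply (Hno (u - (j - i))). apply occ_survivor; auto; lia.
        (* The part of such an occurrence inside the block is a prefix of [P] longer than the
           longest one, [g]. *)
        -- assert (Hb : Nat.testbit GB (j + r - u) = true).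
           { apply HGB. split; [lia|]. rewrite EBc. apply pG_iff; [lia|].
             split; [lia|]. intros k Hk. destruct HOu as [_ HOu].
             symmetry. etransitivity; [apply HOu; fold m; lia|].
             unfold qf; f_equal; lia. }
           apply log2_top in Hb. lia.
      * intros u HOu Hu1 Hu2. lia.
  - assert (Hylt : y < 2 * N) by (apply bits_lt; intros x Hx; apply Hy in Hx;
      destruct Hx; lia).
    destruct (TL y ltac:(lia) Hylt) as [_ [HL1 HL2]].
    remember (smem s (2 * m + 2 + y)) as d eqn:Ed. symmetry in Ed.
    apply Hy in HL1. destruct HL1 as (Hd1 & Hd2 & Hd3 & Hd4 & Hd5).
    apply wp_seq. assign_tac; rewrite ?Ed; try lia. assign_tac; try lia.
    split; [|st; split; [lia|split; [auto|lia]]].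
    split; [par_tac|]. split; [exact HT|]. st.
    split; [lia|]. split; [lia|]. split.
    { replace (i + r - d) with (i - d + r) by lia. apply match_extend; auto.
      eapply match_border; eauto. }
    rewrite HO. replace (j + r - (i + r - d)) with (j - i + d) by lia.
    apply HS; auto; [lia| |].
    + intros u HOu Hu1 Hu2. apply Nat.nlt_ge. intros Hlt.
      (* An earlier surviving start would be a set bit below the lowest one. *)
      assert (Hb : Nat.testbit y (u - (j - i)) = true).
      { apply Hy, occ_survivor; auto; lia. }
      rewrite HL2 in Hb by lia. discriminate.
    + intros u HOu Hu1 Hu2. lia.
Qed.

Lemma block_step_spec s :
  binv s -> env s vj + r <= n ->
  wps block_step (fun T s' => binv s' /\
    length (sout s) <= length (sout s') /\
    T <= 14 + 4 * (length (sout s') - length (sout s)) /\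
    2 * env s vj - env s vi + r <= 2 * env s' vj - env s' vi) s.
Proof.
  intros (Hp & HT & Hi & Hjn & HM & HR) Hj.
  remember (env s vi) as i eqn:Ei. remember (env s vj) as j eqn:Ej.
  symmetry in Ei, Ej.
  pose proof w_lt. pose proof w_pos. pose proof r1w. pose proof rN.
  pose proof N_le_N3. pose proof HM as [Hij _].
  pose proof HT as (TF & TK & TL & TG & TE & TX).
  remember (code b qf j r) as B eqn:EBc. symmetry in EBc.
  assert (HB : B < N) by (rewrite <- EBc, HN; apply code_lt; auto).
  assert (HK := TK i Hi). assert (HE := TE B HB).
  assert (HV : forall a, code b pf a (2 * r) * N + B < N3).
  { intros a. pose proof (code_lt b pf a (2 * r) pf_lt) as Hc.
    replace (2 * r * b) with (r * b + r * b) in Hc by lia.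
    rewrite Nat.pow_add_r, <- HN in Hc. rewrite HN3.
    apply (Nat.mul_le_mono_r _ _ N) in Hc. lia. }
  unfold block_step.
  apply wp_seq. assign_tac; try lia. rewrite EBc.
  apply wp_seq. assign_tac; try lia. cbn [smem set].
  remember (smem s (2 * m + 2 + 5 * N + B)) as EB eqn:EEB.
  remember (smem s (m + 1 + i)) as Ki eqn:EKi. symmetry in EKi.
  rewrite <- EBc in HE.
  match goal with |- context [set ve ?x _] => remember x as e eqn:Ee end.
  assert (He : forall x, Nat.testbit e x = true <->
     x <= r /\ m - i <= x /\ Occ P Q (j + x - m)).
  { rewrite Ee. apply report_bits; auto. }
  apply wp_seq. eapply wp_conseq.
  { apply (report_loop_spec _ j e); auto.
    - par_tac.
    - intros x Hx. apply He in Hx. lia. }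
  st. intros T1 s1 (Hp1 & HM1 & HO1 & Hi1 & Hj1 & HB1 & HT1). cbv beta.
  rewrite Ei in Hi1. rewrite <- HM1 in *.
  assert (HT' : tables s1).
  { unfold tables, fails, masks, logs, bit_table in *. rewrite HM1. exact HT. }
  assert (Hlen : length (sout s1) = length (sout s) + length (bits e)).
  { rewrite HO1, length_app, length_map; auto. }
  assert (Htail : forall a u s2 T0,
    (a = i - r /\ u = 0 /\ r < i) \/ (a = 0 /\ u = r - i /\ i <= r) ->
    par LF s2 -> smem s2 = smem s1 -> sout s2 = sout s1 ->
    env s2 vi = i -> env s2 vj = j -> env s2 vB = B ->
    env s2 vV = code b pf a (2 * r) -> env s2 vu = u ->
    T0 <= 3 ->
    wps (vy ::= Op And (Mem (Var vX +: (Var vV *: Var vN +: Var vB)) >>: Var vu)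
           (Mem (Var vK +: Var vi)) ;;
      If (CLt (Var vi +: Var vr) (Var vm)) Skip
        (vu ::= Var vi +: Var vr +: Cst 1 -: Var vm ;;
         vy ::= (Var vy >>: Var vu) <<: Var vu) ;;
      transition) (fun T s' => binv s' /\
        length (sout s) <= length (sout s') /\
        1 + (1 + (T1 + (T0 + T))) <=
          14 + 4 * (length (sout s') - length (sout s)) /\
        2 * j - i + r <= 2 * env s' vj - env s' vi) s2).
  { intros a u s2 T0 Hau Hp2 HM2 HO2 Hi2 Hj2 HB2 HV2 Hu2 HT0.
    specialize (HV a).
    assert (HX := TX _ HV). rewrite <- EBc in HX.
    apply wp_seq. assign_tac; try lia. rewrite HM2, EKi.
    match goal with |- context [set vy ?x _] => remember x as y eqn:Ey end.
    assert (Hy : forall d, Nat.testbit y d = true <->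
      d <= r /\ d <= i /\ border P (i - d) i /\
      forall k, k < r -> pf (i - d + k) = qf (j + k)).
    { rewrite Ey, HM1. apply (survivor_bits _ _ _ _ a); auto.
      rewrite EBc in *. exact HX. }
    clear Ey.
    apply wp_seq.
    assert (Hfin : forall s3 y3 T3, par LF s3 -> smem s3 = smem s1 ->
      sout s3 = sout s1 -> env s3 vi = i -> env s3 vj = j -> env s3 vB = B ->
      env s3 vy = y3 ->
      (forall d, Nat.testbit y3 d = true <-> survivor i j d) -> T3 <= 3 ->
      wps transition (fun T2 s' => binv s' /\
        length (sout s) <= length (sout s') /\
        1 + (1 + (T1 + (T0 + (1 + (T3 + T2))))) <=
          14 + 4 * (length (sout s') - length (sout s)) /\
        2 * j - i + r <= 2 * env s' vj - env s' vi) s3).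
    { intros s3 y3 T3 Hp3 HM3 HO3 Hi3 Hj3 HB3 Hy3 Hs3 HT3.
      eapply wp_conseq.
      { apply (transition_spec s3 i j y3 (sout s) e); auto; try congruence.
        unfold tables, fails, masks, logs, bit_table in *. rewrite HM3.
        exact HT'. }
      intros T s' (K1 & K2 & K3 & K4). split; [auto|].
      rewrite K3, HO3, Hlen. split; [lia|]. split; [lia|auto]. }
    eapply wp_if_lt; [ev_tac; lia|ev_tac| |]; intros Hlt.
    - apply wp_skip. apply (Hfin _ y 1); auto; [par_tac|].
      intros d. rewrite Hy. unfold survivor. split.
      + intros (K1 & K2 & K3 & K4). repeat (split; [auto; lia|]). auto.
      + intros (K1 & K2 & K3 & _ & K4). auto.
    - apply wp_seq. assign_tac; try lia. assign_tac.
      eapply (Hfin _ _ 3);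
        [par_tac|auto|auto|auto|auto|auto|st; reflexivity| |lia].
      intros d. rewrite cut_bits by (intros x Hx; apply Hy in Hx; lia).
      rewrite Hy. unfold survivor. split.
      + intros (K0 & K1 & K2 & K3 & K4). split; [auto|]. split; [auto|].
        split; [auto|]. split; [lia|auto].
      + intros (K1 & K2 & K3 & K5 & K4). split; [lia|auto]. }
  apply wp_seq.
  assert (Hrr : forall s2, par LF s2 ->
    evs s2 (Var vrb +: Var vrb) (2 * r * b)).
  { intros s2 Hp2. replace (2 * r * b) with (r * b + r * b) by lia.
    ev_tac. lia. }
  eapply wp_if_lt; [ev_tac|ev_tac| |]; intros Hri.
  - apply wp_seq. eapply wp_assign.
    { apply (ev_blockP _ _ _ (i - r) (2 * r)); [env_tac|env_tac|env_tac| | | |].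
      - ev_tac. lia.
      - lia.
      - apply Hrr; auto.
      - lia. }
    cbv beta. assign_tac; [lia|].
    apply (Htail (i - r) 0 _ 3); auto; par_tac.
  - apply wp_seq. eapply wp_assign.
    { apply (ev_blockP _ _ _ 0 (2 * r)); [env_tac|env_tac|env_tac| | | |].
      - ev_tac. lia.
      - lia.
      - apply Hrr; auto.
      - lia. }
    cbv beta. assign_tac; [lia|].
    apply (Htail 0 (r - i) _ 3); auto; par_tac.
Qed.

(** * Amortized cost of the block scan *)

Lemma blocks_spec s :
  binv s ->
  wps blocks (fun T s' => binv s' /\ n - env s' vj < r /\
    T <= 15 * ((2 * n - (2 * env s vj - env s vi)) / r) + 4 * occ P Q + 1) s.
Proof.
  intros HI. pose proof w_lt. pose proof w_pos. unfold blocks.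
  eapply wp_conseq.
  { apply (wp_while w _ _ A _ _ _ (fun _ => r - 1) (fun s => n - env s vj)
      (fun s => 15 * ((2 * n - (2 * env s vj - env s vi)) / r)
                + 4 * (occ P Q - length (sout s))) binv); auto.
    - intros s1 (Hp & _ & _ & Hj & _). split; ev_tac; lia.
    - clear s HI. intros s HI Hlt. pose proof HI as (_ & _ & Hi & Hj & HM & _).
      pose proof HM as [Hij _].
      eapply wp_conseq; [apply block_step_spec; [auto|lia]|].
      intros T s' (HI' & Hl & HT & Hpot). split; [auto|].
      pose proof HI' as (_ & _ & Hi' & Hj' & HM' & HR').
      pose proof HM' as [Hij' _].
      apply reported_length in HR'; auto.
      (* A gain of [r] lowers the quotient by at least one, which pays 15 units: one test and the 14
         steps of a round without its reports. *)
      assert (Hd : (2 * n - (2 * env s' vj - env s' vi)) / r + 1 <=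
                   (2 * n - (2 * env s vj - env s vi)) / r).
      { rewrite <- Nat.div_add by lia. apply Nat.Div0.div_le_mono. lia. }
      lia. }
  cbv beta. intros T s' (HI' & Hstop & HT). split; [auto|]. lia.
Qed.

Lemma fast_spec s :
  par L6 s -> fails s -> env s vr = r -> sout s = [] ->
  wps fast (fun T s' => kinv s' /\ fails s' /\ n - env s' vj < r /\
    T <= 100 * t + 4 * m + 15 * (2 * n / r) + 4 * occ P Q) s.
Proof.
  intros Hp HF Er HO. pose proof w_lt. pose proof w_pos. pose proof rN.
  pose proof N_le_N3. unfold fast.
  apply wp_seq. eapply wp_conseq; [apply setup_spec; auto|].
  intros T1 s1 (Hp1 & HM1 & HO1 & HT1). cbv beta.
  assert (HF1 : fails s1) by (unfold fails; rewrite HM1; auto).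
  apply wp_seq. eapply wp_conseq; [apply masks_loop_spec; auto|].
  intros T2 s2 (Hp2 & HK2 & HO2 & Hfr2 & HT2). cbv beta.
  apply wp_seq. eapply wp_conseq; [apply logs_loop_spec; auto|].
  intros T3 s3 (Hp3 & HL3 & HO3 & Hfr3 & HT3). cbv beta.
  apply wp_seq. eapply wp_conseq.
  { apply (table_spec vG vN chkG pG); auto; try (cbn [nth LF]; lia).
    exact chkG_ok. }
  cbn [nth LF]. intros T4 s4 (Hp4 & HO4 & Hfr4 & HG4 & HT4). cbv beta.
  apply wp_seq. eapply wp_conseq.
  { apply (table_spec vE vN chkE pE); auto; try (cbn [nth LF]; lia).
    exact chkE_ok. }
  cbn [nth LF]. intros T5 s5 (Hp5 & HO5 & Hfr5 & HE5 & HT5). cbv beta.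
  apply wp_seq. eapply wp_conseq.
  { apply (table_spec vX vN3 chkX pX); auto; try (cbn [nth LF]; lia).
    exact chkX_ok. }
  cbn [nth LF]. intros T6 s6 (Hp6 & HO6 & Hfr6 & HX6 & HT6). cbv beta.
  assert (HTab : tables s6).
  { split; [|split; [|split; [|split; [|split]]]].
    - intros l H1' H2'. rewrite Hfr6, Hfr5, Hfr4, Hfr3, Hfr2 by lia. auto.
    - intros i Hi. rewrite Hfr6, Hfr5, Hfr4, Hfr3 by lia. auto.
    - intros y H1' H2'. rewrite !Hfr6, !Hfr5, !Hfr4 by lia. auto.
    - intros B HB. rewrite Hfr6, Hfr5 by lia. auto.
    - intros B HB. rewrite Hfr6 by lia. auto.
    - auto. }
  apply wp_seq. assign_tac; [lia|]. apply wp_seq. assign_tac; [lia|].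
  eapply wp_conseq.
  { apply blocks_spec. split; [par_tac|]. split; [exact HTab|]. st.
    split; [lia|]. split; [lia|]. split; [apply match_0|].
    rewrite HO6, HO5, HO4, HO3, HO2, HO1, HO. apply reported_0. }
  st. intros T7 s7 (HI & Hend & HT7).
  destruct HI as (Hp7 & HTab7 & Hi7 & Hj7 & HM7 & HR7).
  split; [|split; [apply HTab7|split; [auto|]]].
  { split; [apply par_LF_L6; auto|]. auto. }
  replace (2 * n - (2 * 0 - 0)) with (2 * n) in HT7 by lia.
  (* One row costs [O(r)], hence at most [12 N]; the largest table then costs at most
     [12 N3 N <= 12 t]. *)
  assert (C : 9 * (r + 1) + 6 <= 12 * N) by lia.
  assert (C0 : N3 <= t).
  { apply Nat.le_trans with (N3 * N); auto.
    rewrite <- (Nat.mul_1_r N3) at 1. apply Nat.mul_le_mono_l; lia. }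
  assert (C1 : N * (9 * (r + 1) + 6) <= 12 * t).
  { apply Nat.le_trans with (N * (12 * N)); [apply Nat.mul_le_mono_l; auto|].
    lia. }
  assert (C2 : N3 * (9 * (r + 1) + 6) <= 12 * t).
  { apply Nat.le_trans with (N3 * (12 * N)); [apply Nat.mul_le_mono_l; auto|].
    lia. }
  lia.
Qed.

End Fast.

(** The bound [A] combines two limits: addresses are words, and space is [O(t + m)]. *)
Lemma main_spec s :
  par L6 s -> sout s = [] -> A = Nat.min (2 ^ w) (2 * m + 2 + t) ->
  wps main (fun T s' => Permutation (sout s') (occurrences P Q) /\
    exists u, t < 2 ^ (8 * S u * b) /\
    T <= 200 * (n / Nat.max 1 (Nat.min u (q / 2)) + t + m + occ P Q)) s.
Proof.
  intros Hp HO HA. pose proof w_lt. pose proof w_pos. unfold main.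
  eapply wp_if_lt; [ev_tac|ev_tac| |]; intros Hnm; [lia|].
  eapply wp_if_eq; [ev_tac|ev_tac; lia| |]; intros Hm0; [lia|].
  apply wp_seq. eapply wp_conseq; [apply failure_spec; auto|].
  intros T1 s1 (Hp1 & HF1 & HO1 & HT1). cbv beta.
  apply wp_seq. eapply wp_conseq; [apply choose_r_spec; auto|].
  intros T2 s2 (Hp2 & HM2 & HO2 & (u & Hu1 & Hu2 & Er) & HT2). cbv beta.
  assert (HF2 : fails s2) by (unfold fails; rewrite HM2; auto).
  apply wp_seq. assign_tac; [lia|]. apply wp_seq. assign_tac; [lia|].
  remember (Nat.min u (q / 2)) as r eqn:Erq.
  match goal with |- wp _ _ _ _ _ _ ?x => remember x as s3 eqn:Es3 end.
  assert (Hp3 : par L6 s3) by (subst s3; par_tac).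
  assert (HF3 : fails s3) by (subst s3; exact HF2).
  assert (HO3 : sout s3 = []) by (subst s3; cbn; congruence).
  assert (Er3 : env s3 vr = r) by (subst s3; exact Er).
  assert (HK3 : kinv s3).
  { split; [auto|]. subst s3. st. split; [lia|]. split; [lia|].
    split; [apply match_0|]. rewrite HO2, HO1, HO. apply reported_0. }
  assert (Ei3 : env s3 vi = 0) by (subst s3; reflexivity).
  assert (Ej3 : env s3 vj = 0) by (subst s3; reflexivity).
  clear Es3. apply wp_seq.
  eapply wp_if_lt; [ev_tac; lia|ev_tac| |];
    rewrite Nat.shiftr_shiftr, Nat.shiftr_div_pow2; change (2 ^ (1 + 1)) with 4;
    intros H4.
  - apply wp_skip. eapply wp_conseq; [apply naive_spec; auto|].
    intros T4 s4 [HP4 HT4]. split; [auto|]. exists u. split; [auto|].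
    assert (n < 4 * m).
    { pose proof (Nat.div_mod_eq n 4).
      pose proof (Nat.mod_upper_bound n 4 ltac:(lia)). lia. }
    lia.
  - eapply wp_if_eq; [ev_tac|ev_tac; lia| |]; intros Hr.
    + apply wp_skip. eapply wp_conseq; [apply naive_spec; auto|].
      intros T4 s4 [HP4 HT4]. split; [auto|]. exists u. split; [auto|].
      (* For [r = 0] the divisor is 1, and the linear search meets the bound. *)
      rewrite <- Erq, Hr. change (Nat.max 1 0) with 1. rewrite Nat.div_1_r. lia.
    + assert (Hr1 : 1 <= r) by lia.
      assert (Hq2 : 2 * r <= q).
      { pose proof (Nat.div_mod_eq q 2). lia. }
      assert (Hm4 : 4 * m <= n).
      { pose proof (Nat.div_mod_eq n 4). lia. }
      assert (Hrb : r <= r * b)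
        by (rewrite <- (Nat.mul_1_r r) at 1; apply Nat.mul_le_mono_l; auto).
      assert (Hub : r * b <= u * b) by (apply Nat.mul_le_mono_r; lia).
      set (N := 2 ^ (r * b)).
      assert (HN2 : 2 <= N).
      { change 2 with (2 ^ 1). apply Nat.pow_le_mono_r; lia. }
      pose proof (Nat.mul_le_mono_r _ _ N HN2) as Hc2.
      pose proof (Nat.mul_le_mono_r _ _ N Hc2) as Hc3.
      pose proof (Nat.mul_le_mono_r _ _ N Hc3) as Hc4.
      assert (HN8 : N ^ 8 <= t).
      { unfold N. rewrite <- Nat.pow_mul_r. etransitivity; [|exact Hu1].
        apply Nat.pow_le_mono_r; lia. }
      (* The factor 16 is the least value of [N^4], as [N >= 2]. *)
      assert (HN4 : 16 * (N * N * N * N) <= t).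
      { etransitivity; [|exact HN8].
        replace (N ^ 8) with (N * N * N * N * (N * N * N * N)) by (cbn; ring).
        apply Nat.mul_le_mono_r. lia. }
      assert (Hbw : 8 * (r * b) <= w).
      { apply Nat.nlt_ge. intros Hlt.
        apply (Nat.pow_lt_mono_r 2) in Hlt; [|lia].
        unfold N in HN8. rewrite <- Nat.pow_mul_r in HN8.
        rewrite (Nat.mul_comm (r * b) 8) in HN8. lia. }
      assert (HN3 : 6 * N + N * N * N <= 2 * (N * N * N * N)) by lia.
      (* The limit [2^w] needs [4 m <= n < 2^w]; the limit [2 m + 2 + t] only needs that [t] covers
         the tables. *)
      assert (HAN : 2 * m + 2 + 6 * N + N * N * N <= A).
      { rewrite HA. apply Nat.min_glb; lia. }
      eapply wp_conseq.
      { apply (fast_spec r N (N * N * N)); auto; try lia. }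
      intros T4 s4 (HK4 & HF4 & Hend & HT4). cbv beta.
      eapply wp_conseq; [apply naive_spec; auto|].
      intros T5 s5 [HP5 HT5]. split; [auto|]. exists u. split; [auto|].
      rewrite <- Erq. rewrite Nat.max_r by lia.
      destruct HK4 as (_ & Hi4 & _).
      assert (Hrt : r <= t).
      { pose proof (Nat.pow_gt_lin_r 2 r ltac:(lia)).
        assert (2 ^ r <= N) by (apply Nat.pow_le_mono_r; lia). lia. }
      assert (Hdiv : 2 * n / r <= 2 * (n / r) + 1).
      { apply Nat.lt_succ_r. apply Nat.Div0.div_lt_upper_bound.
        pose proof (Nat.div_mod_eq n r).
        pose proof (Nat.mod_upper_bound n r ltac:(lia)). lia. }
      lia.
Qed.

End Verification.

Lemma main_long w inP inQ A P Q s :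
  env s vm = length P -> env s vn = length Q -> sout s = [] ->
  length Q < length P ->
  wp w inP inQ A main
    (fun T s' => Permutation (sout s') (occurrences P Q) /\ T = 1) s.
Proof.
  intros Em En HO H. unfold main.
  eapply wp_if_lt; [constructor; eassumption..| |lia].
  intros _. apply wp_skip. split; auto. rewrite HO.
  destruct (occurrences P Q) as [|k l] eqn:E; auto. exfalso.
  assert (Hk : In k (occurrences P Q)) by (rewrite E; left; auto).
  apply in_occurrences in Hk as (_ & u & _ & Hu & _). lia.
Qed.

Lemma occurrences_nil Q : occurrences [] Q = seq 1 (length Q).
Proof.
  unfold occurrences.
  etransitivity; [apply filter_ext with (g := fun _ => true)|].
  - reflexivity.
  - induction (seq 1 (length Q)) as [|x l IH]; cbn; congruence.
Qed.

Lemma main_nil w inP inQ A P Q s :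
  env s vm = 0 -> env s vn = length Q -> sout s = [] -> P = [] ->
  length Q < 2 ^ w -> 2 <= w ->
  wp w inP inQ A main
    (fun T s' => Permutation (sout s') (occurrences P Q) /\
       T <= 3 * length Q + 4) s.
Proof.
  intros Em En HO -> Hn Hw. rewrite occurrences_nil. unfold main.
  pose proof (Nat.pow_gt_lin_r 2 w ltac:(lia)).
  eapply wp_if_lt; [constructor; eassumption..|lia|]. intros _.
  eapply wp_if_eq; [constructor; eassumption|constructor; lia| |lia]. intros _.
  apply wp_seq. eapply wp_assign; [constructor; lia|cbv beta].
  eapply wp_conseq.
  { apply (wp_while w _ _ A _ _ _ (fun s => env s vj) (fun _ => length Q)
      (fun s => 3 * (length Q - env s vj))
      (fun s' => env s' vn = length Q /\ env s' vj <= length Q /\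
        sout s' = seq 1 (env s' vj))).
    - cbn [env set upd Nat.eqb sout]. repeat split; auto; lia.
    - intros s1 (Hn1 & _). split; constructor; auto.
    - intros s1 (Hn1 & Hj & HO1) Hlt. apply wp_seq.
      eapply wp_assign; [|cbv beta].
      { apply ev_add; [constructor; reflexivity|constructor; lia|lia]. }
      eapply wp_out; [constructor; reflexivity|cbv beta].
      cbn [env set upd Nat.eqb sout emit].
      split; [|lia]. split; [auto|]. split; [lia|].
      rewrite HO1, Nat.add_1_r, seq_S. reflexivity. }
  cbn [env set upd Nat.eqb sout emit].
  intros T s' ((_ & Hj & HO1) & Hstop & HT).
  replace (env s' vj) with (length Q) in * by lia.
  rewrite HO1. split; [reflexivity|lia].
Qed.

(** * Size bounds *)

(** Rounding characters up to whole bits at most squares the alphabet size, which costs a factor 2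
    in the logarithm. *)
Lemma pow2_char_bits sigma :
  2 <= sigma -> sigma <= 2 ^ char_bits sigma /\
  2 ^ char_bits sigma <= sigma ^ 2 /\ 1 <= char_bits sigma.
Proof.
  intros Hs. unfold char_bits.
  destruct (Nat.log2_up_spec sigma) as [H1 H2]; [lia|].
  pose proof (Nat.log2_up_pos sigma ltac:(lia)) as H3.
  repeat split; auto.
  replace (Nat.log2_up sigma) with (S (Nat.pred (Nat.log2_up sigma))) by lia.
  rewrite Nat.pow_succ_r', Nat.pow_2_r.
  apply Nat.mul_le_mono; lia.
Qed.

(** That is, [log_sigma t = O(r)]. If [u] limits [r], then [t < 2^(8 (u + 1) b) <= sigma^(16 (u +
    1))], and [u + 1 <= 2 max(1, u)] gives 32. If [q / 2] does, then [w <= c^2 q b] and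
    [q <= 3 max(1, q / 2)] give [6 c^2]. *)
Lemma t_le_sigma_pow c n w sigma q t u :
  word_length c n w -> 2 <= sigma -> chars_per_word c n sigma w q ->
  1 <= q -> t < 2 ^ w -> t < 2 ^ (8 * S u * char_bits sigma) ->
  t <= sigma ^ ((32 + 6 * (c * c)) * Nat.max 1 (Nat.min u (q / 2))).
Proof.
  intros [_ Hw] Hs [_ Hq] Hq1 Htw Htu.
  destruct (pow2_char_bits sigma Hs) as (_ & H2 & _).
  set (b := char_bits sigma) in *.
  assert (P : forall k, 2 ^ (b * k) <= sigma ^ (2 * k)).
  { intros k. rewrite !Nat.pow_mul_r. apply Nat.pow_le_mono_l; auto. }
  destruct (Nat.le_gt_cases u (q / 2)) as [Hu|Hu].
  - rewrite Nat.min_l by auto. apply Nat.lt_le_incl in Htu.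
    etransitivity; [exact Htu|].
    replace (8 * S u * b) with (b * (8 * S u)) by lia.
    etransitivity; [apply P|]. apply Nat.pow_le_mono_r; [lia|].
    assert (2 * (8 * S u) <= 32 * Nat.max 1 u) by lia. nia.
  - rewrite Nat.min_r by lia. apply Nat.lt_le_incl in Htw.
    etransitivity; [exact Htw|].
    assert (Hwb : w <= b * (c * c * q)).
    { etransitivity; [exact Hw|].
      etransitivity; [apply Nat.mul_le_mono_l; exact Hq|].
      apply Nat.eq_le_incl. ring. }
    apply Nat.le_trans with (2 ^ (b * (c * c * q)));
      [apply Nat.pow_le_mono_r; lia|].
    etransitivity; [apply P|]. apply Nat.pow_le_mono_r; [lia|].
    assert (Hq3 : q <= 3 * Nat.max 1 (q / 2)).
    { pose proof (Nat.div_mod_eq q 2).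
      pose proof (Nat.mod_upper_bound q 2 ltac:(lia)). lia. }
    apply (Nat.mul_le_mono_l _ _ (2 * (c * c))) in Hq3. lia.
Qed.

Section RealBounds.

Local Open Scope R_scope.

Lemma logb_le_pow sigma t k :
  (2 <= sigma)%nat -> (1 <= t)%nat -> (t <= sigma ^ k)%nat ->
  logb (INR sigma) (INR t) <= INR k.
Proof.
  intros Hs Ht H. unfold logb.
  assert (Hs' : 2 <= INR sigma) by (apply (le_INR 2); auto).
  assert (Ht' : 1 <= INR t) by (apply (le_INR 1); auto).
  assert (Hln : 0 < ln (INR sigma))
    by (rewrite <- ln_1; apply ln_increasing; lra).
  apply Rmult_le_reg_r with (ln (INR sigma)); auto.
  unfold Rdiv. rewrite Rmult_assoc, Rinv_l, Rmult_1_r by lra.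
  rewrite <- ln_pow by lra. rewrite <- pow_INR.
  apply le_INR in H. destruct H as [H|H].
  - left. apply ln_increasing; lra.
  - right. rewrite H; auto.
Qed.

Lemma logb_pos sigma t :
  (2 <= sigma)%nat -> (2 <= t)%nat -> 0 < logb (INR sigma) (INR t).
Proof.
  intros Hs Ht. unfold logb. apply le_INR in Hs, Ht. cbn in Hs, Ht.
  apply Rdiv_lt_0_compat; rewrite <- ln_1; apply ln_increasing; lra.
Qed.

Lemma INR_div_le n d : (1 <= d)%nat -> INR (n / d) <= INR n / INR d.
Proof.
  intros Hd. assert (0 < INR d) by (apply (lt_INR 0); lia).
  apply Rmult_le_reg_r with (INR d); auto.
  unfold Rdiv. rewrite Rmult_assoc, Rinv_l, Rmult_1_r by lra.
  rewrite <- mult_INR. apply le_INR. rewrite Nat.mul_comm.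
  apply Nat.Div0.mul_div_le.
Qed.

Lemma blocks_le sigma t n d k :
  (2 <= sigma)%nat -> (2 <= t)%nat -> (1 <= d)%nat ->
  (t <= sigma ^ (k * d))%nat ->
  INR (n / d) <= INR k * (INR n / logb (INR sigma) (INR t)).
Proof.
  intros Hs Ht Hd H.
  pose proof (logb_pos sigma t Hs Ht) as Hp.
  pose proof (logb_le_pow sigma t (k * d) Hs ltac:(lia) H) as Hl.
  rewrite mult_INR in Hl. pose proof (INR_div_le n d Hd) as Hn.
  assert (Hd' : 0 < INR d) by (apply (lt_INR 0); lia).
  pose proof (pos_INR n). eapply Rle_trans; [exact Hn|].
  set (L := logb (INR sigma) (INR t)) in *.
  apply Rmult_le_reg_r with (INR d); auto.
  apply Rmult_le_reg_r with L; auto.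
  replace (INR n / INR d * INR d * L) with (INR n * L) by (field; lra).
  replace (INR k * (INR n / L) * INR d * L) with (INR n * (INR k * INR d))
    by (field; lra).
  apply Rmult_le_compat_l; auto.
Qed.

End RealBounds.

(** * The compiled program and the final bounds *)

Definition prog : program := comp 0 main.

Lemma prog_correct w b q t P Q T s' :
  1 <= b -> 1 <= q -> q * b <= w ->
  (forall x, nth x P 0 < 2 ^ b) -> (forall x, nth x Q 0 < 2 ^ b) ->
  length P < 2 ^ w -> length Q < 2 ^ w -> t < 2 ^ w ->
  forall A,
  run w (pack q b P) (pack q b Q) A main
    (St (fun i => nth i [length P; length Q; b; q; w; t] 0) (fun _ => 0) [])
    T s' ->
  exists T' k, halts_in prog w (pack q b P) (pack q b Q)
      (init [length P; length Q; b; q; w; t]) T' k /\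
    out k = sout s' /\ top k <= A /\ T' <= csize main * T.
Proof.
  intros Hb Hq Hqb HP HQ Hm Hn Ht A HR.
  pose proof (Nat.pow_gt_lin_r 2 w ltac:(lia)) as Hw.
  assert (Hin : forall l, (forall x, nth x l 0 < 2 ^ b) ->
    forall x, nth x (pack q b l) 0 < 2 ^ w).
  { intros l Hl x. rewrite pack_nth by lia.
    apply Nat.lt_le_trans with (2 ^ (q * b)).
    - apply code_lt; auto.
    - apply Nat.pow_le_mono_r; lia. }
  destruct (comp_correct w (pack q b P) (pack q b Q) A (Hin P HP) (Hin Q HQ)
    prog (csize main) _ _ _ _ HR (init [length P; length Q; b; q; w; t]))
    as (T' & k & HS & Hpc & (R1 & R2 & R3 & R4) & _ & HT).
  - exists [], []. rewrite app_nil_r. auto.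
  - repeat split; auto. cbn; lia.
  - split; [|intros; cbn; lia].
    intros x. cbn [env].
    do 6 (destruct x as [|x]; [cbn [nth]; auto; nia|]).
    destruct x; cbn; lia.
  - vm_compute. reflexivity.
  - auto.
  - exists T', k. split; [|split; [auto|split; [auto|exact HT]]].
    split; auto. unfold step.
    rewrite (proj2 (nth_error_None _ _)); auto.
    unfold prog. rewrite csize_eq, Hpc. cbn [pc init]. lia.
Qed.

Theorem theorem2 (c : nat) :
  exists (prog : program) (K : R),
  forall (w sigma q t : nat) (P Q : list nat),
    let m := length P in
    let n := length Q in
    let b := char_bits sigma in
    word_length c n w ->
    2 <= sigma ->
    chars_per_word c n sigma w q ->
    string_over sigma P ->
    string_over sigma Q ->
    m < 2 ^ w ->
    2 <= t < 2 ^ w ->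
    exists (T : nat) (s : config),
      halts_in prog w (pack q b P) (pack q b Q) (init [m; n; b; q; w; t]) T s /\
      Permutation (out s) (occurrences P Q) /\
      (INR T <= K * (INR n / logb (INR sigma) (INR t) + INR t + INR m
                     + INR (occ P Q)))%R /\
      (INR (space prog s) <= K * (INR t + INR m))%R.
Proof.
  set (k1 := 32 + 6 * (c * c)).
  (* The space is at most [num_regs prog + 2 m + 2 + t], and [t >= 2] absorbs the constants. *)
  set (k2 := num_regs prog + 3).
  exists prog, (INR (csize main * 200 * k1 + k2)).
  intros w sigma q t P Q m n b Hw Hs Hq HP HQ Hm [Ht2 Htw].
  destruct (pow2_char_bits sigma Hs) as (Hb1 & _ & Hb). fold b in Hb1, Hb.
  pose proof Hw as [Hn _]. pose proof Hq as [Hqb Hq2]. fold b in Hqb, Hq2.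
  assert (Hq1 : 1 <= q).
  { unfold bitlen in Hq2. destruct q; [|lia]. cbn in Hq2. lia. }
  assert (Hchar : forall l, string_over sigma l ->
    forall x, nth x l 0 < 2 ^ b).
  { intros l Hl x. destruct (Nat.lt_ge_cases x (length l)) as [Hx|Hx].
    - apply Nat.lt_le_trans with sigma; auto.
      unfold string_over in Hl. rewrite Forall_forall in Hl.
      apply Hl, nth_In; auto.
    - rewrite nth_overflow by auto. apply pow2_pos. }
  assert (Hw2 : 2 <= w).
  { destruct w as [|[|w']]; [cbn in Htw; lia|cbn in Htw; lia|lia]. }
  set (s0 := St (fun i => nth i [m; n; b; q; w; t] 0) (fun _ => 0) []).
  set (A := Nat.min (2 ^ w) (2 * m + 2 + t)).
  assert (HA : A <= 2 * m + 2 + t) by apply Nat.le_min_r.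
  assert (HR : wp w (pack q b P) (pack q b Q) A main (fun T s' =>
    Permutation (sout s') (occurrences P Q) /\
    exists d, 1 <= d /\ t <= sigma ^ (k1 * d) /\
      T <= 200 * (n / d + t + m + occ P Q)) s0).
  (* In the degenerate cases [n < m] and [m = 0] the time is bounded without [n / d], so any
     admissible divisor will do; [w] is one. *)
  { assert (H1 : t <= sigma ^ (k1 * w)).
    { apply Nat.lt_le_incl in Htw. etransitivity; [exact Htw|].
      apply Nat.le_trans with (sigma ^ w); [apply Nat.pow_le_mono_l; lia|].
      apply Nat.pow_le_mono_r; [lia|]. unfold k1; nia. }
    destruct (Nat.lt_ge_cases n m) as [Hnm|Hnm].
    { eapply wp_conseq; [apply (main_long w _ _ A P Q); auto|].
      intros T s' [HP' ->]. split; auto. exists w. repeat split; auto; lia. }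
    destruct (Nat.eq_dec m 0) as [Hm0|Hm0].
    { assert (EP : P = []) by (destruct P; [auto|discriminate]).
      eapply wp_conseq; [apply (main_nil w _ _ A P Q); auto|].
      intros T s' [HP' HT]. split; auto. exists w. split; [lia|]. split; auto.
      assert (occ P Q = n).
      { unfold occ. rewrite EP, occurrences_nil, length_seq. auto. }
      fold n in HT. lia. }
    eapply wp_conseq.
    { apply (main_spec w b q t A P Q); auto.
      - lia.
      - unfold A. apply Nat.min_glb_lt; fold m; lia.
      - intros x _. reflexivity. }
    intros T s' (HP' & u & Hu & HT). split; auto.
    exists (Nat.max 1 (Nat.min u (q / 2))). split; [lia|]. split; auto.
    eapply t_le_sigma_pow; eauto. }
  destruct HR as (T & s' & HR & HP' & d & Hd & Htd & HT).
  destruct (prog_correct w b q t P Q T s' Hb Hq1 Hqb (Hchar P HP) (Hchar Q HQ)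
    Hm Hn Htw A HR) as (T' & k & HH & HO & Htop & HT').
  exists T', k. split; [exact HH|]. split; [rewrite HO; auto|].
  pose proof (blocks_le sigma t n d k1 Hs Ht2 Hd Htd) as HB.
  pose proof (logb_pos sigma t Hs Ht2) as HL.
  set (x := (INR n / logb (INR sigma) (INR t))%R) in *.
  assert (Hx : (0 <= x)%R).
  { unfold x. apply Rmult_le_pos; [apply pos_INR|].
    left; apply Rinv_0_lt_compat; auto. }
  pose proof (pos_INR t). pose proof (pos_INR m).
  pose proof (pos_INR (occ P Q)).
  assert (Hk1 : (1 <= INR k1)%R) by (apply (le_INR 1); unfold k1; lia).
  rewrite plus_INR, !mult_INR.
  pose proof (pos_INR (csize main)) as Hc. pose proof (pos_INR k2) as Hk2.
  split.
  - assert (E : (INR T' <= INR (csize main) * INR 200 *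
        (INR (n / d) + INR t + INR m + INR (occ P Q)))%R).
    { rewrite <- !plus_INR, <- !mult_INR. apply le_INR.
      etransitivity; [exact HT'|]. rewrite <- Nat.mul_assoc.
      apply Nat.mul_le_mono_l; auto. }
    eapply Rle_trans; [exact E|].
    assert (E2 : (INR (n / d) + INR t + INR m + INR (occ P Q) <=
      INR k1 * (x + INR t + INR m + INR (occ P Q)))%R) by nra.
    pose proof (pos_INR 200) as H200.
    assert (E3 : (0 <= INR (csize main) * INR 200)%R) by nra.
    apply (Rmult_le_compat_l _ _ _ E3) in E2.
    eapply Rle_trans; [exact E2|]. rewrite Rmult_plus_distr_r.
    assert (0 <= INR k2 * (x + INR t + INR m + INR (occ P Q)))%R by
      (apply Rmult_le_pos; lra).
    lra.
  - assert (E : (INR (space prog k) <= INR (k2 * (t + m)))%R).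
    { apply le_INR. unfold space, k2. nia. }
    rewrite mult_INR, plus_INR in E. rewrite Rmult_plus_distr_r.
    assert (0 <= INR (csize main) * INR 200 * INR k1 * (INR t + INR m))%R.
    { pose proof (pos_INR 200). repeat apply Rmult_le_pos; lra. }
    lra.
Qed.
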